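(* Let $\nu\ge0$, $0<\beta\le 1$, $\alpha,p>0$, $0<\lambda<\alpha^\beta$ and $n\in\{0,1,2,\ldots\}$. The probability mass function $\delta_\beta(n|\alpha,pt,\lambda)=\mathbb{P}[Q_\beta(t,\lambda)=n]$ of the fractional negative binomial process solves the following fractional differential equation in the time variable $t$: $$\frac1p\,\partial_t^\nu\delta_\beta(n|\alpha,pt,\lambda)=\partial_t^{\nu-1}\big[(\log(\alpha)-\psi(pt))\,\delta_\beta(n|\alpha,pt,\lambda)\big]+\int_0^\infty p_\beta(n|y,\lambda)\,\log(y)\,\partial_t^{\nu-1}g(y|\alpha,pt)\,dy,\qquad t>0,$$ where $\delta_\beta(n|\alpha,0,\lambda)=1$ if $n=0$ and is zero otherwise.
   Context: $\psi(x)=\Gamma'(x)/\Gamma(x)$ is the digamma function. Gamma process: $\{\Gamma(t)\}_{t\ge0}$ is the gamma subordinator with $\Gamma(t)\sim G(\alpha,pt)$, with density $g(y|\alpha,pt)=\frac{\alpha^{pt}}{\Gamma(pt)}y^{pt-1}e^{-\alpha y}$, $y>0$ (and $g(y|\alpha,0)=0$). Fractional Poisson process (FPP): $\{N_\beta(t,\lambda)\}_{t\ge0}$ has pmf $p_\beta(n|t,\lambda)=\mathbb{P}[N_\beta(t,\lambda)=n]=\frac{(\lambda t^{\beta})^n}{n!}\sum_{k=0}^{\infty}\frac{(n+k)!}{k!}\frac{(-\lambda t^{\beta})^k}{\Gamma(\beta(k+n)+1)}$. Fractional negative binomial process (FNBP): $Q_\beta(t,\lambda)=N_\beta(\Gamma(t),\lambda)$,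 with $\{N_\beta(t,\lambda)\}$ independent of $\{\Gamma(t)\}$, so $\delta_\beta(n|\alpha,pt,\lambda)=\int_0^\infty p_\beta(n|y,\lambda)g(y|\alpha,pt)\,dy$ for $t>0$. Riemann–Liouville derivative in $t$: for an integer $m\ge1$, $\partial_t^\nu f(t)=\frac{1}{\Gamma(m-\nu)}\frac{d^m}{dt^m}\int_0^t\frac{f(s)}{(t-s)^{\nu-m+1}}ds$ if $m-1<\nu<m$, $\partial_t^mf=\frac{d^m}{dt^m}f$, $\partial_t^0f=f$; for negative order $-\mu<0$, $\partial_t^{-\mu}f(t)=\frac{1}{\Gamma(\mu)}\int_0^t(t-s)^{\mu-1}f(s)\,ds$ (Riemann–Liouville integral).
   Formalization: The equation is asserted when its right-hand side exists, proved for n≥1 or ν a positive integer; for n=0 and other ν the right-hand side is undefined, since (log α−ψ(ps))δ_β(0|α,ps,λ) ~ 1/(ps) is not integrable at s=0. *)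

(* Defs.v *)
From HB Require Import structures.
From mathcomp Require Import all_boot all_order all_algebra.
From mathcomp Require Import all_classical all_reals all_analysis.

Set Implicit Arguments.
Unset Strict Implicit.
Unset Printing Implicit Defensive.
Import Order.TTheory GRing.Theory Num.Theory.
Import numFieldNormedType.Exports.

Local Open Scope classical_set_scope.
Local Open Scope ring_scope.

Section special_functions.
Context {R : realType}.

(* Euler's integral: meaningful for 0 < x, the only arguments used below. *)
Definition Gamma (x : R) : R :=
  \int[lebesgue_measure]_(s in `]0, +oo[) (s `^ (x - 1) * expR (- s)).

Definition digamma (x : R) : R := derive1 Gamma x / Gamma x.

Definition gamma_pdf (alpha a y : R) : R :=
  if (0 < y) && (0 < a)
  then alpha `^ a / Gamma a * y `^ (a - 1) * expR (- (alpha * y))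
  else 0.

Definition fpp_pmf (beta lam : R) (n : nat) (t : R) : R :=
  (lam * t `^ beta) ^+ n / n`!%:R *
  limn (series (fun k : nat =>
    (n + k)`!%:R / k`!%:R *
    ((- (lam * t `^ beta)) ^+ k / Gamma (beta * (k + n)%:R + 1)))).

End special_functions.

Section riemann_liouville.
Context {R : realType}.
Implicit Types (nu t : R) (f : R -> R).

(* When nu >= 0 is not an integer, m := (Num.truncn nu).+1 is the integer such
   that m - 1 < nu < m. *)
Definition RL_deriv nu f t : R :=
  if nu < 0 then
    (Gamma (- nu))^-1 *
    \int[lebesgue_measure]_(s in `[0, t]) ((t - s) `^ (- nu - 1) * f s)
  else if nu \is a Num.nat then derive1n (Num.truncn nu) f t
  else
    let m := (Num.truncn nu).+1 in
    (Gamma (m%:R - nu))^-1 *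
    derive1n m (fun u => \int[lebesgue_measure]_(s in `[0, u])
       (f s / (u - s) `^ (nu - m%:R + 1))) t.

Definition derivable_n (m : nat) f t : Prop :=
  \forall u \near t, forall k, (k < m)%N -> derivable (derive1n k f) u 1.

(* RL_deriv is total (a divergent integral or a missing derivative yields a
   default value); RL_exists says that the integrals and derivatives occurring
   in RL_deriv nu f t are genuine. *)
Definition RL_exists nu f t : Prop :=
  [/\ nu < 0 ->
        lebesgue_measure.-integrable `[0, t]
          (fun s => ((t - s) `^ (- nu - 1) * f s)%:E),
      0 <= nu -> nu \is a Num.nat -> derivable_n (Num.truncn nu) f t &
      0 <= nu -> nu \isn't a Num.nat ->
        let m := (Num.truncn nu).+1 in
        (\forall u \near t, lebesgue_measure.-integrable `[0, u]
           (fun s => (f s / (u - s) `^ (nu - m%:R + 1))%:E)) /\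
        derivable_n m (fun u => \int[lebesgue_measure]_(s in `[0, u])
           (f s / (u - s) `^ (nu - m%:R + 1))) t].

End riemann_liouville.

Section processes.
Context {R : realType} {d : measure_display} {T : measurableType d}.
Variable P : probability T R.

(* The processes are families indexed by R, but only the times t >= 0 matter. *)

(* Right continuity of an integer-valued path means that it is locally constant
   to the right. *)
Definition is_fpp (beta lam : R) (N : R -> {RV P >-> nat}) : Prop :=
  [/\ forall t n, 0 <= t ->
        P (N t @^-1` [set n]) = (fpp_pmf beta lam n t)%:E,
      forall w s t, 0 <= s -> s <= t -> (N s w <= N t w)%N &
      forall w t, 0 <= t -> \forall s \near t^'+, N s w = N t w].

(* Subordinator whose increment over [s, t] has law G(alpha, p (t - s)). *)
Definition is_gamma_process (alpha p : R) (G : R -> {RV P >-> R}) : Prop :=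
  [/\ forall w, G 0 w = 0,
      forall w s t, 0 <= s -> s <= t -> G s w <= G t w,
      forall w t, 0 <= t -> (fun s => G s w) @ t^'+ --> G t w,
      forall s t (B : set R), 0 <= s -> s < t -> measurable B ->
        P [set w | B (G t w - G s w)] =
        (\int[lebesgue_measure]_(y in B)
            (gamma_pdf alpha (p * (t - s)) y)%:E)%E &
      forall (k : nat) (u : nat -> R) (B : nat -> set R),
        0 <= u 0%N -> (forall i, u i <= u i.+1) ->
        (forall i, measurable (B i)) ->
        P (\bigcap_(i < k) [set w | B i (G (u i.+1) w - G (u i) w)]) =
        (\prod_(i < k) P [set w | B i (G (u i.+1) w - G (u i) w)%R])%E].

Definition independent_processes
    (N : R -> {RV P >-> nat}) (G : R -> {RV P >-> R}) : Prop :=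
  forall (k l : nat) (u v : nat -> R) (A : nat -> set nat) (B : nat -> set R),
    (forall i, 0 <= u i) -> (forall j, 0 <= v j) ->
    (forall j, measurable (B j)) ->
    P ((\bigcap_(i < k) (N (u i) @^-1` A i)) `&`
       (\bigcap_(j < l) (G (v j) @^-1` B j))) =
    (P (\bigcap_(i < k) (N (u i) @^-1` A i)) *
     P (\bigcap_(j < l) (G (v j) @^-1` B j)))%E.

Definition fnbp (N : R -> {RV P >-> nat}) (G : R -> {RV P >-> R})
    (t : R) (w : T) : nat := N (G t w) w.

Definition fnbp_pmf (N : R -> {RV P >-> nat}) (G : R -> {RV P >-> R})
    (n : nat) (t : R) : R := fine (P [set w | fnbp N G t w = n]).

End processes.

Section equation.
Context {R : realType}.
Variables (nu beta alpha p lam : R) (n : nat) (delta : R -> R).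

Definition drift (t : R) : R := (ln alpha - digamma (p * t)) * delta t.

Definition log_integrand (t y : R) : R :=
  fpp_pmf beta lam n y * ln y *
  RL_deriv (nu - 1) (fun s => gamma_pdf alpha (p * s) y) t.

(* The right-hand side is meaningful at t.  This is a genuine restriction: as
   - digamma (p * s) ~ 1 / (p * s) when s tends to 0, drift is not integrable
   at 0 if delta tends to 1 there, which happens when n = 0; its derivative of
   order nu - 1 then makes sense only if nu is a positive integer. *)
Definition rhs_exists (t : R) : Prop :=
  [/\ RL_exists (nu - 1) drift t,
      forall y, 0 < y ->
        RL_exists (nu - 1) (fun s => gamma_pdf alpha (p * s) y) t &
      lebesgue_measure.-integrable `]0, +oo[
        (fun y => (log_integrand t y)%:E)].

End equation.

(* Main.v *)
Require Import Defs.
From HB Require Import structures.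
From mathcomp Require Import all_boot all_order all_algebra.
From mathcomp Require Import all_classical all_reals all_analysis.
From mathcomp Require Import measurable_realfun ring lra.

Set Implicit Arguments.
Unset Strict Implicit.
Unset Printing Implicit Defensive.
Import Order.TTheory GRing.Theory Num.Theory.
Import numFieldNormedType.Exports.

Local Open Scope classical_set_scope.
Local Open Scope ring_scope.

(** Seen as a function of the time [s], the gamma density
    [gamma_pdf alpha (p * s) y] has logarithmic derivative
    [p * (ln alpha - digamma (p * s) + ln y)].  Integrating against the law
    [phi y] of [N y] at [n] gives the equation of order one,
    [p^-1 * delta' = drift + H], where [H s] is the integral over [y] of
    [phi y * ln y * gamma_pdf alpha (p * s) y] ([fnbp_driftE]).  The equation of
    order [nu] is this one, to which the Riemann-Liouville operator of order
    [nu - 1] is applied.  If [nu] is a positive integer the operator is an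
    iterated derivative.  Otherwise, with [K] the integer part of [nu] and
    [m := nu - K], it is, up to the factor [(Gamma (1 - m))^-1], the [K]-th
    derivative of [abel m f], the integral of [f s / (t - s) `^ m] over [[0, t]]
    ([RL_deriv_pred]).  Three points carry the proof.

    The mixture formula: [delta t] is the integral of [phi] against the gamma
    density ([fnbp_probability]), by discretising the values of the subordinator.

    The exchange of the operator with the integral over [y].  The derivatives in
    [s] of the density are combinations of atoms
    [a s * ln y ^+ i * y `^ (p * s - 1) * expR (- (alpha * y))], whose integrals
    obey the same differentiation rule as the atoms themselves; so it suffices to
    exchange the integrals in [s] and [y], by Fubini, and to differentiate under
    the Abel kernel ([derive1n_integral_atom], [derive1n_integral_abel_atom]).
    The latter is possible because stretching [[0, t]] to [[0, 1]] moves [t] out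
    of the domain of integration and out of the singularity ([is_derive_abel]).

    The behaviour at time [0], which a nonlocal operator sees.  For [0 < n],
    [phi y] is at most the probability that [N y] is positive, which is [O(y^beta)]
    ([one_sub_fpp_pmf0_le]); hence [delta] and [H] extend smoothly to
    [s > - beta / p], with [delta = 0] at [0], and no boundary term appears when
    a derivative crosses the Abel kernel ([derive1nS_abel]).  For [n = 0],
    [delta] tends to [1] and the drift is equivalent to [1 / (p * s)], so unless
    [nu] is a positive integer the right-hand side does not exist
    ([fnbp_rhs_zero_undefined]). *)


(** * Smooth functions on a right half-line *)

Section smooth.
Context {R : realType}.
Implicit Types (e x p c : R) (f g : R -> R) (k : nat).

(** Only the values of [f] on [(e, +oo)] matter: the functions below are given by
    formulas that are meaningless further left. *)
Definition smooth_upto k e f :=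
  forall j x, (j < k)%N -> e < x -> derivable (derive1n j f) x 1.

Lemma smooth_upto0 e f : smooth_upto 0 e f.
Proof. by move=> j x; rewrite ltn0. Qed.

Definition smooth e f := forall k, smooth_upto k e f.

Lemma is_derive_derive1 f x d : is_derive x (1 : R) f d ->
  derivable f x 1 /\ derive1 f x = d.
Proof. by move=> [df <-]; rewrite derive1E. Qed.

Lemma derivable_is_derive1 f x : derivable f x 1 -> is_derive x 1 f (derive1 f x).
Proof. by move=> df; rewrite derive1E; exact: derivableP. Qed.

Lemma near_gt_eq e x f g : (forall y, e < y -> f y = g y) -> e < x ->
  {near x, f =1 g}.
Proof.
by move=> fg ex; near=> y; apply: fg; near: y; exact: lt_nbhsr.
Unshelve. all: by end_near. Qed.

Lemma eq_derive1 e x f g : (forall y, e < y -> f y = g y) -> e < x ->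
  derive1 f x = derive1 g x.
Proof. by move=> fg ex; rewrite !derive1E; exact/near_eq_derive/(near_gt_eq fg). Qed.

Lemma eq_derive1n k e x f g : (forall y, e < y -> f y = g y) -> e < x ->
  (derive1n k f) x = (derive1n k g) x.
Proof.
elim: k f g x => [|k IH] f g x fg ex; first by rewrite !derive1n0 fg.
by rewrite !derive1Sn; apply: IH => // y ey; exact: eq_derive1 fg ey.
Qed.

Lemma eq_smooth_upto k e f g : (forall y, e < y -> f y = g y) ->
  smooth_upto k e f -> smooth_upto k e g.
Proof.
move=> fg sf j x jk ex; have := sf j x jk ex; apply: near_eq_derivable.
by apply: near_gt_eq ex => y ey; exact: eq_derive1n fg ey.
Qed.

(** Smoothness is obtained from this by induction on [k], for a whole family of
    functions closed under differentiation, without computing the [k]-th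
    derivative of any of them. *)
Lemma smooth_uptoS k e f g : (forall x, e < x -> is_derive x 1 f (g x)) ->
  smooth_upto k e g -> smooth_upto k.+1 e f.
Proof.
move=> fg sg [|j] x jk ex; first by have [] := fg _ ex.
rewrite derive1Sn; move: (j) x jk ex; apply: eq_smooth_upto sg => y ey.
by have /is_derive_derive1[_ ->] := fg _ ey.
Qed.

Lemma smooth_uptoW k e f : smooth_upto k.+1 e f -> smooth_upto k e f.
Proof. by move=> sf j x jk ex; apply: sf => //; exact: ltnW. Qed.

Lemma smooth_upto_is_derive k e f x : smooth_upto k.+1 e f -> e < x ->
  is_derive x 1 f (derive1 f x).
Proof.
by move=> sf ex; apply: derivable_is_derive1; have := sf 0%N x isT ex.
Qed.

Lemma smooth_upto_derive1 k e f : smooth_upto k.+1 e f ->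
  smooth_upto k e (derive1 f).
Proof. by move=> sf j x jk ex; rewrite -derive1Sn; exact: sf. Qed.

Lemma smooth_uptoD k e f g : smooth_upto k e f -> smooth_upto k e g ->
  smooth_upto k e (fun x => f x + g x).
Proof.
elim: k f g => [|k IH] f g sf sg; first exact: smooth_upto0.
apply: (@smooth_uptoS _ _ _ (fun x => derive1 f x + derive1 g x)).
  move=> x ex; have := smooth_upto_is_derive sf ex.
  by have := smooth_upto_is_derive sg ex => ? ?; exact: is_deriveD.
by apply: IH; [exact: smooth_upto_derive1 sf|exact: smooth_upto_derive1 sg].
Qed.

Lemma smooth_uptoM k e f g : smooth_upto k e f -> smooth_upto k e g ->
  smooth_upto k e (fun x => f x * g x).
Proof.
elim: k f g => [|k IH] f g sf sg; first exact: smooth_upto0.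
apply: (@smooth_uptoS _ _ _ (fun x => f x * derive1 g x + g x * derive1 f x)).
  move=> x ex; have := smooth_upto_is_derive sf ex.
  by have := smooth_upto_is_derive sg ex => ? ?; exact: is_deriveM.
by apply: smooth_uptoD; apply: IH;
  [exact: smooth_uptoW sf|exact: smooth_upto_derive1 sg|
   exact: smooth_uptoW sg|exact: smooth_upto_derive1 sf].
Qed.

Lemma smooth_cst e c : smooth e (cst c).
Proof.
move=> k; elim: k c => [|k IH] c; first exact: smooth_upto0.
by apply: (@smooth_uptoS _ _ _ (cst 0)) (IH 0) => x _; exact: is_derive_cst.
Qed.

Lemma smoothD e f g : smooth e f -> smooth e g ->
  smooth e (fun x => f x + g x).
Proof. by move=> sf sg k; exact: smooth_uptoD (sf k) (sg k). Qed.

Lemma smoothM e f g : smooth e f -> smooth e g ->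
  smooth e (fun x => f x * g x).
Proof. by move=> sf sg k; exact: smooth_uptoM (sf k) (sg k). Qed.

Lemma smoothMl e c f : smooth e f -> smooth e (fun x => c * f x).
Proof. by move=> sf; exact: smoothM (@smooth_cst e c) sf. Qed.

Lemma smoothB e f g : smooth e f -> smooth e g ->
  smooth e (fun x => f x - g x).
Proof.
move=> sf sg; have -> : (fun x => f x - g x) = (fun x => f x + -1 * g x).
  by apply/funext => x; rewrite mulN1r.
exact: smoothD sf (@smoothMl _ (-1) _ sg).
Qed.

Lemma smoothV e f : (forall x, e < x -> f x != 0) -> smooth e f ->
  smooth e (fun x => (f x)^-1).
Proof.
move=> f0 sf; elim=> [|k IH]; first exact: smooth_upto0.
apply: (@smooth_uptoS _ _ _ (fun x => -1 * ((f x)^-1 * ((f x)^-1 * derive1 f x)))).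
  move=> x ex; have df := smooth_upto_is_derive (sf 1%N) ex.
  apply: is_derive_eq; first exact: (is_deriveV (f0 _ ex) df).
  by rewrite /GRing.scale/= mulN1r mulNr expr2 invfM -mulrA.
apply: smooth_uptoM; first exact: smooth_cst.
apply: (smooth_uptoM IH); apply: (smooth_uptoM IH).
exact: smooth_upto_derive1 (sf k.+1).
Qed.

Lemma eq_smooth e f g : (forall y, e < y -> f y = g y) ->
  smooth e f -> smooth e g.
Proof. by move=> fg sf k; apply: eq_smooth_upto (sf k). Qed.

Lemma smooth_derive1 e f : smooth e f -> smooth e (derive1 f).
Proof. by move=> sf k; exact: smooth_upto_derive1 (sf k.+1). Qed.

Lemma smooth_is_derive e f x : smooth e f -> e < x ->
  is_derive x 1 f (derive1 f x).
Proof. by move=> sf ex; apply: (smooth_upto_is_derive (sf 1%N)). Qed.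

Lemma smoothW e e' f : e <= e' -> smooth e f -> smooth e' f.
Proof. by move=> ee' sf k j x jk ex; apply: (sf k) => //; exact: le_lt_trans ex. Qed.

Lemma smooth_id e : smooth e id.
Proof.
case=> [|k]; first exact: smooth_upto0.
apply: smooth_uptoS (@smooth_cst e 1 k) => x _; exact: is_derive_id.
Qed.

Lemma is_derive_affine f p c x d : is_derive (p * x + c) 1 f d ->
  is_derive x (1 : R) (fun y => f (p * y + c)) (p * d).
Proof.
move=> df; have H : is_derive x (1 : R) (fun y => p * y + c) p.
  by apply: is_derive_eq; rewrite /GRing.scale/=; ring.
rewrite [p * d]mulrC.
exact: (@is_derive1_comp _ f (fun y => p * y + c) x d p df H).
Qed.

Lemma smooth_affine e e' p c f : (forall x, e' < x -> e < p * x + c) ->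
  smooth e f -> smooth e' (fun x => f (p * x + c)).
Proof.
move=> pe sf k; elim: k f sf => [|k IH] f sf; first exact: smooth_upto0.
apply: (@smooth_uptoS _ _ _ (fun x => p * (derive1 f) (p * x + c))).
  by move=> x ex; exact/is_derive_affine/(smooth_is_derive sf)/pe.
apply: smooth_uptoM; first exact: smooth_cst.
exact/IH/smooth_derive1.
Qed.

Lemma is_derive_expRM c x :
  is_derive x (1 : R) (fun x => expR (c * x)) (c * expR (c * x)).
Proof.
have -> : (fun x => expR (c * x)) = (fun x => expR (c * x + 0)).
  by apply/funext => y; rewrite addr0.
by have := @is_derive_affine expR c 0 x _ (is_derive_expR _); rewrite addr0.
Qed.

Lemma smooth_expRM e c : smooth e (fun x => expR (c * x)).
Proof.
elim=> [|k IH]; first exact: smooth_upto0.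
apply: (smooth_uptoS (fun x _ => is_derive_expRM c x)).
by apply: smooth_uptoM; [exact: smooth_cst|exact: IH].
Qed.

Lemma smooth_powR r : smooth 0 (fun x : R => x `^ r).
Proof.
move=> k; elim: k r => [|k IH] r; first exact: smooth_upto0.
have sg : smooth_upto k 0 (fun x : R => r * x `^ (r - 1)).
  by apply: smooth_uptoM; [exact: smooth_cst|exact: IH].
by apply: (smooth_uptoS _ sg) => x x0; exact: is_derive1_powR.
Qed.

Lemma smooth_continuous e f x : smooth e f -> e < x -> {for x, continuous f}.
Proof.
move=> sf ex; apply/differentiable_continuous/derivable1_diffP.
by have := sf 1%N 0%N x isT ex.
Qed.

Lemma smooth_derivable_n e f x m : smooth e f -> e < x -> derivable_n m f x.
Proof.
move=> sf ex; near=> u => k km; apply: (sf k.+1) => //.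
by near: u; exact: lt_nbhsr.
Unshelve. all: by end_near. Qed.

Lemma derive1nD e k f g x : smooth e f -> smooth e g -> e < x ->
  derive1n k (fun x => f x + g x) x = (derive1n k f) x + (derive1n k g) x.
Proof.
move=> sf sg ex; elim: k f g sf sg => [|k IH] f g sf sg; first by [].
rewrite !derive1Sn -IH; [|exact: smooth_derive1 sf|exact: smooth_derive1 sg].
apply: (@eq_derive1n _ e _ _ _ _ ex) => y ey.
by have /is_derive_derive1[] := is_deriveD (smooth_is_derive sf ey)
  (smooth_is_derive sg ey).
Qed.

Lemma derive1nMl e k f c x : smooth e f -> e < x ->
  derive1n k (fun x => c * f x) x = c * (derive1n k f) x.
Proof.
move=> sf ex; elim: k f sf => [//|k IH] f sf.
rewrite !derive1Sn -IH; [|exact: smooth_derive1 sf].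
apply: (@eq_derive1n _ e _ _ _ _ ex) => y ey.
have /is_derive_derive1[_ ->] := is_deriveM (is_derive_cst c y 1)
  (smooth_is_derive sf ey).
by rewrite /GRing.scale/= mulr0 addr0.
Qed.

Lemma derive1nB e k f g x : smooth e f -> smooth e g -> e < x ->
  derive1n k (fun x => f x - g x) x = (derive1n k f) x - (derive1n k g) x.
Proof.
move=> sf sg ex; have sg' := @smoothMl _ (-1) _ sg.
have -> : (fun x => f x - g x) = (fun x => f x + -1 * g x).
  by apply/funext => y; rewrite mulN1r.
by rewrite (derive1nD _ sf sg' ex) (derive1nMl _ _ sg ex) mulN1r.
Qed.

End smooth.


(** * Real-valued integrable functions *)

Section integrable_real.
Context d (T : measurableType d) {R : realType}.
Variables (mu : {measure set T -> \bar R}) (A : set T).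
Hypothesis mA : measurable A.
Implicit Types (f g : T -> R) (c : R).

Lemma integrable_realD f g : mu.-integrable A (EFin \o f) ->
  mu.-integrable A (EFin \o g) ->
  mu.-integrable A (EFin \o (fun x => f x + g x)).
Proof. by move=> fi gi; have := integrableD mA fi gi. Qed.

Lemma integrable_realZ c f : mu.-integrable A (EFin \o f) ->
  mu.-integrable A (EFin \o (fun x => c * f x)).
Proof. by move=> fi; have := integrableZl mA c fi. Qed.

Lemma eq_integrable_real f g : (forall x, A x -> f x = g x) ->
  mu.-integrable A (EFin \o f) -> mu.-integrable A (EFin \o g).
Proof.
by move=> fg; apply: eq_integrable => // x /set_mem Ax /=; rewrite fg.
Qed.

Lemma le_integrable_real f g : measurable_fun A f ->
  (forall x, A x -> `|f x| <= g x) -> mu.-integrable A (EFin \o g) ->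
  mu.-integrable A (EFin \o f).
Proof.
move=> mf fg; apply: le_integrable => //; first exact/measurable_EFinP.
by move=> x Ax /=; rewrite lee_fin (le_trans (fg _ Ax))// ler_norm.
Qed.

Lemma integrable_real_measurable f : mu.-integrable A (EFin \o f) ->
  measurable_fun A f.
Proof. by move=> /integrableP[/measurable_EFinP]. Qed.

Lemma integrable_restrictT f : mu.-integrable A (EFin \o f) <->
  mu.-integrable setT (EFin \o (f \_ A)).
Proof. by rewrite -restrict_EFin; exact: integrable_mkcond. Qed.

End integrable_real.

Section product_integrable.
Context d1 d2 (T1 : measurableType d1) (T2 : measurableType d2) {R : realType}.
Variables (m1 : {sigma_finite_measure set T1 -> \bar R})
  (m2 : {sigma_finite_measure set T2 -> \bar R}).

Lemma integrable_prodM (f : T1 -> R) (g : T2 -> R) :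
  m1.-integrable setT (EFin \o f) -> m2.-integrable setT (EFin \o g) ->
  (m1 \x m2)%E.-integrable setT (EFin \o (fun z => f z.1 * g z.2)).
Proof.
move=> fi gi.
have mf := integrable_real_measurable fi.
have mg := integrable_real_measurable gi.
apply/integrable12ltyP.
  apply/measurable_EFinP/measurable_funM.
    by apply: measurableT_comp mf _; exact: measurable_fst.
  by apply: measurableT_comp mg _; exact: measurable_snd.
have [_ fy] := integrableP _ _ _ fi; have [_ gy] := integrableP _ _ _ gi.
have E x : (\int[m2]_y `|(f x * g y)%:E| =
    `|f x|%:E * \int[m2]_y `|(EFin \o g) y|)%E.
  rewrite -ge0_integralZl//; last first.
    by apply: measurableT_comp => //; exact/measurable_EFinP.
  by apply: eq_integral => y _ /=; rewrite normrM EFinM.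
under eq_integral do rewrite /= E.
have gf : (\int[m2]_y `|(EFin \o g) y|)%E \is a fin_num.
  by rewrite ge0_fin_numE// integral_ge0.
rewrite -(fineK gf) ge0_integralZr//; last 2 first.
  by apply: measurableT_comp => //; exact: measurableT_comp.
  by rewrite lee_fin fine_ge0// integral_ge0.
have ff : (\int[m1]_x `|f x|%:E)%E \is a fin_num.
  by rewrite ge0_fin_numE// integral_ge0.
by rewrite -(fineK ff) -EFinM ltry.
Qed.

End product_integrable.

(** * Improper integrals by exhaustion *)

Section exhaustion.
Context {R : realType}.
Notation mu := (@lebesgue_measure R).
Variables (a b : R^nat) (A : set R) (f F : R -> R) (l : R).
Hypothesis ab : forall k, a k < b k.
Hypothesis a_decr : forall k, a k.+1 <= a k.
Hypothesis b_incr : forall k, b k <= b k.+1.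
Hypothesis AE : A = \bigcup_k [set` `[a k, b k]].
Hypothesis cf : forall x, A x -> {for x, continuous f}.
Hypothesis dF : forall x, A x -> is_derive x 1 F (f x).
Hypothesis Fl : F (b k) - F (a k) @[k --> \oo] --> l.

Let sub_A k : `[a k, b k] `<=` A.
Proof. by rewrite AE => x abx; exists k. Qed.

Let cont_itv k : {within `[a k, b k], continuous f}.
Proof.
apply: continuous_in_subspaceT => x; rewrite inE => abx.
by apply: cf; exact: sub_A abx.
Qed.

Let int_itv k : (\int[mu]_(x in `[a k, b k]) (f x)%:E = (F (b k) - F (a k))%:E)%E.
Proof.
rewrite EFinB; apply: continuous_FTC2 => //.
- have dFk x : x \in `[a k, b k] -> derivable F x 1.
    by move=> xab; have [] := dF (sub_A xab).
  have cFk x : x \in `[a k, b k] -> {for x, continuous F}.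
    by move=> /dFk ?; exact/differentiable_continuous/derivable1_diffP.
  split.
  + by move=> x xab; apply: dFk; exact: subset_itv_oo_cc xab.
  + by apply/cvg_at_right_filter/cFk; rewrite in_itv/= lexx ltW.
  + by apply/cvg_at_left_filter/cFk; rewrite in_itv/= lexx ltW.
- move=> x xab.
  by have /is_derive_derive1[] := dF (sub_A (subset_itv_oo_cc xab)).
Qed.

Let nd_itv : nondecreasing_seq (fun k => [set` `[a k, b k]]).
Proof.
apply/nondecreasing_seqP => k; apply/subsetPset => x /=.
rewrite !in_itv/= => /andP[ax xb].
by rewrite (le_trans (a_decr k) ax) (le_trans xb (b_incr k)).
Qed.

Let mf_itv k : measurable_fun `[a k, b k] (EFin \o f).
Proof.
by have /integrableP[] :=
  continuous_compact_integrable (@segment_compact _ (a k) (b k)) (@cont_itv k).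
Qed.

Let mA : measurable A.
Proof. by rewrite AE; apply: bigcup_measurable => k _. Qed.

Let mfA : measurable_fun A (EFin \o f).
Proof. by rewrite AE; apply/measurable_fun_bigcup => //. Qed.

(** Along an exhausting sequence of segments the integrals of a nonnegative
    function converge to its integral, so a primitive whose increments converge
    is enough. *)
Lemma exhaustion_integrable : (forall x, A x -> 0 <= f x) ->
  mu.-integrable A (EFin \o f).
Proof.
move=> f0; apply/integrableP; split => //.
have -> : (\int[mu]_(x in A) `|(EFin \o f) x| = \int[mu]_(x in A) (f x)%:E)%E.
  by apply: eq_integral => x /set_mem Ax /=; rewrite ger0_norm// f0.
have : (\int[mu]_(x in [set` `[a k, b k]]) (f x)%:E @[k --> \oo] -->
    \int[mu]_(x in A) (f x)%:E)%E.
  rewrite [in X in _ --> X]AE; apply: ge0_nondecreasing_set_cvg_integral => //.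
  by move=> k x /sub_A Ax; rewrite lee_fin f0.
under eq_fun do rewrite int_itv.
move=> /cvg_lim <- //.
by rewrite (cvg_lim _ (cvg_EFin (nearW _ _) Fl)) ?ltry.
Qed.

Lemma exhaustion_FTC : mu.-integrable A (EFin \o f) ->
  \int[mu]_(x in A) f x = l.
Proof.
move=> intf.
have [] := @dominated_convergence _ _ R mu A mA
  (fun k => (fun x => (f x)%:E) \_ `[a k, b k]) (EFin \o f) (abse \o (EFin \o f)).
- move=> k; apply/(measurable_restrict _ _ _) => //.
  by rewrite setIC setIidl//; exact: mf_itv.
- exact: mfA.
- apply: aeW => x; rewrite AE => -[k _ abx].
  apply: cvg_near_cst; near=> n; rewrite patchE ifT// inE.
  have /subsetPset : ([set` `[a k, b k]] <= [set` `[a n, b n]])%O.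
    by apply: nd_itv; near: n; exact: nbhs_infty_ge.
  exact.
- exact: integrable_abse.
- apply: aeW => x k Ax /=; rewrite patchE; case: ifPn => // _.
  by rewrite abse0.
move=> _ _; rewrite /Rintegral => /cvg_lim <- //.
rewrite (_ : (fun n => _) = (fun k => (F (b k) - F (a k))%:E)).
  by rewrite (cvg_lim _ (cvg_EFin _ Fl))//; exact: nearW.
apply/funext => k; rewrite -int_itv -integral_mkcondr setIidr//.
Unshelve. all: by end_near. Qed.

End exhaustion.

(** * Moments against the gamma kernel *)

Section gamma_kernel.
Context {R : realType}.
Notation mu := (@lebesgue_measure R).
Implicit Types (al c d y : R) (i : nat).

(** Starting at [2] makes the end points distinct for every [k]. *)
Lemma itv0y_exhaust :
  [set` `]0, +oo[] = \bigcup_k [set` `[k.+2%:R^-1, k.+2%:R : R]].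
Proof.
apply/seteqP; split => [y|y [k _]] /=; rewrite !in_itv/=; last first.
  by move=> /andP[ky _]; rewrite andbT (lt_le_trans _ ky)// invr_gt0 ltr0n.
rewrite andbT => y0.
have [m _ hm] := nbhs_infty_ger y; have [k _ hk] := nbhs_infty_ger y^-1.
exists (maxn m k) => //=; rewrite in_itv/=; apply/andP; split; last first.
  by apply: hm => /=; rewrite (leq_trans (leq_maxl m k))// -addn2 leq_addr.
rewrite -[leRHS]invrK lef_pV2 ?posrE ?invr_gt0// ?ltr0n//.
by apply: hk => /=; rewrite (leq_trans (leq_maxr m k))// -addn2 leq_addr.
Qed.

Lemma cvg_invSS_powR c : 0 < c -> (k.+2%:R^-1 : R) `^ c @[k --> \oo] --> (0 : R).
Proof.
move=> c0; apply: (@cvg_comp _ _ _ (fun k => k.+2%:R^-1 : R) (fun x => x `^ c)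
  _ (0^'+) _ _ (powR_cvg0 c0)).
move=> A [e /= e0 eA]; have [m _ hm] := nbhs_infty_gtr e^-1.
exists m => // k /= mk; apply: eA => /=; last by rewrite invr_gt0 ltr0n.
rewrite sub0r normrN gtr0_norm ?invr_gt0 ?ltr0n//.
rewrite -[ltRHS]invrK ltf_pV2 ?posrE ?invr_gt0 ?ltr0n//.
by apply: hm => /=; rewrite (leq_trans mk)// -addn2 leq_addr.
Qed.

(** This is [ln x <= x] at [x = al / d * y], exponentiated. *)
Lemma powR_expN_bounded d al : 0 < d -> 0 < al ->
  exists2 K, 0 <= K & forall y, 0 < y -> y `^ d * expR (- (al * y)) <= K.
Proof.
move=> d0 al0; exists (expR (- (d * ln (al / d)))); first exact: expR_ge0.
move=> y y0; rewrite /powR gt_eqF// -expRD ler_expR -lerBrDr -opprB opprK.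
have ad0 : 0 < al / d by exact: divr_gt0.
have : d * ln (al / d * y) <= d * (al / d * y).
  by rewrite ler_wpM2l ?(ltW d0)// ltW// ln_sublinear// mulr_gt0.
rewrite lnM ?posrE// mulrDr.
have -> : d * (al / d * y) = al * y by field; rewrite gt_eqF.
lra.
Qed.

(** Comparison with [y `^ (c - 1) / (1 + y `^ c) ^+ 2], which has the right
    order at [0] and a primitive with finite limits at both ends. *)
Lemma integrable_powR_exp c al : 0 < c -> 0 < al ->
  mu.-integrable `]0, +oo[ (fun y => (y `^ (c - 1) * expR (- (al * y)))%:E).
Proof.
move=> c0 al0.
pose h y : R := y `^ (c - 1) / (1 + y `^ c) ^+ 2.
pose H y : R := - c^-1 * (1 + y `^ c)^-1.
have pos y : 0 < 1 + y `^ c by rewrite ltr_pwDl// powR_ge0.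
have mh : mu.-integrable `]0, +oo[ (EFin \o h).
  apply: (@exhaustion_integrable _ (fun k => k.+2%:R^-1) (fun k => k.+2%:R)
    _ h H c^-1).
  - move=> k; rewrite (@lt_trans _ _ 1)//; last by rewrite ltr1n.
    by rewrite invf_lt1 ?ltr1n ?ltr0n.
  - by move=> k; rewrite lef_pV2 ?posrE ?ltr0n// ler_nat.
  - by move=> k; rewrite ler_nat.
  - exact: itv0y_exhaust.
  - move=> y; rewrite /= in_itv/= andbT => y0.
    apply: (@smooth_continuous _ 0) => //.
    apply: smoothM; first exact: smooth_powR.
    apply: smoothV; first by move=> x x0; rewrite expf_neq0// gt_eqF.
    have s1 : smooth 0 (fun y : R => 1 + y `^ c).
      by apply: smoothD; [exact: smooth_cst|exact: smooth_powR].
    exact: smoothM.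
  - move=> y; rewrite /= in_itv/= andbT => y0.
    have d1 : is_derive y (1 : R) (fun y : R => 1 + y `^ c) (c * y `^ (c - 1)).
      have := is_derive1_powR c y0 => ?.
      by apply: is_derive_eq; rewrite add0r mul1r.
    have d2 := is_deriveV (f := fun y => 1 + y `^ c) (lt0r_neq0 (pos y)) d1.
    have := is_deriveZ (- c^-1) d2; rewrite /GRing.scale/=.
    move=> d3; apply: (is_derive_eq d3); rewrite /h.
    by field; rewrite !gt_eqF.
  - rewrite (_ : (fun k => _) = (fun k => c^-1 * (1 - (k.+2%:R^-1) `^ c) *
        (1 + (k.+2%:R^-1) `^ c)^-1)); last first.
      apply/funext => k; rewrite /H.
      have -> : (k.+2%:R : R) `^ c = ((k.+2%:R^-1) `^ c)^-1.
        by rewrite -(@powR_inv1 _ k.+2%:R) ?ler0n// -powRrM mulN1r powRN invrK.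
      have : 0 < (k.+2%:R^-1 : R) `^ c by rewrite powR_gt0// invr_gt0 ltr0n.
      set x := _ `^ c => x0; field.
      by rewrite !gt_eqF//; lra.
    have cx := cvg_invSS_powR c0.
    have c1 : (1 - k.+2%:R^-1 `^ c : R) @[k --> \oo] --> (1 - 0 : R).
      by apply: cvgB; [exact: cvg_cst|exact: cx].
    have c2 : ((1 + k.+2%:R^-1 `^ c)^-1 : R) @[k --> \oo] --> ((1 + 0)^-1 : R).
      apply: cvgV; first by rewrite addr0.
      by apply: cvgD; [exact: cvg_cst|exact: cx].
    have := cvgM (cvgM (cvg_cst c^-1) c1) c2.
    by rewrite subr0 addr0 invr1 !mulr1; exact.
  - by move=> y _; rewrite divr_ge0 ?powR_ge0// exprn_ge0// ltW.
have c20 : 0 < 2 * c by rewrite mulr_gt0.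
have [K K0 hK] := powR_expN_bounded c20 al0.
apply: le_integrable_real (integrable_realZ _ (2 * (1 + K)) mh) => //.
  apply: measurable_funM; first exact: measurable_funS (measurable_powR _).
  by apply: measurableT_comp => //; apply: measurableT_comp.
move=> y; rewrite /= in_itv/= andbT => y0.
rewrite ger0_norm ?mulr_ge0 ?powR_ge0 ?expR_ge0//.
rewrite /h mulrCA ler_wpM2l ?powR_ge0// ler_pdivlMr ?exprn_gt0//.
have e1 : expR (- (al * y)) <= 1.
  by rewrite -expR0 ler_expR oppr_le0 mulr_ge0// ltW.
have := hK y y0; rewrite mulrC mulrC powRrM (powRAC _ 2) powR_mulrn ?powR_ge0//.
have := powR_ge0 y c; have := expR_ge0 (- (al * y)).
move: (y `^ c) (expR _) e1 => x e e1 e0 x0 xK.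
have : 0 <= (1 - x) ^+ 2 by exact: sqr_ge0.
nra.
Qed.

(** From [x <= expR x] at [x = e * `|ln y|], where [e = d / i.+1] leaves room
    for the power [i]. *)
Lemma ln_pow_le i d : 0 < d -> exists2 K, 0 <= K &
  forall y, 0 < y -> `|ln y| ^+ i <= K * (y `^ d + y `^ (- d)).
Proof.
move=> d0; pose e := d / i.+1%:R; have e0 : 0 < e by rewrite divr_gt0 ?ltr0n.
exists (e^-1 ^+ i); first by rewrite exprn_ge0// invr_ge0 ltW.
move=> y y0; apply: (@le_trans _ _ (e^-1 ^+ i * expR (d * `|ln y|))).
  have -> : `|ln y| = e^-1 * (e * `|ln y|) by rewrite mulKf// gt_eqF.
  rewrite exprMn ler_wpM2l ?exprn_ge0 ?invr_ge0 ?(ltW e0)//.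
  apply: (@le_trans _ _ (expR (e * `|ln y|) ^+ i)).
    rewrite lerXn2r ?nnegrE ?expR_ge0 ?(mulr_ge0 (ltW e0))//.
    by apply: le_trans (expR_ge1Dx _); rewrite lerDr.
  rewrite -expRM_natl ler_expR mulKf ?gt_eqF// mulrA ler_wpM2r//.
  rewrite /e mulrCA ler_piMr ?(ltW d0)// ler_pdivrMr ?ltr0n// mul1r ler_nat.
  exact: leqW.
rewrite ler_wpM2l ?exprn_ge0 ?invr_ge0 ?(ltW e0)//.
rewrite /powR gt_eqF//; have [l0|l0] := leP 0 (ln y).
  by rewrite ger0_norm// lerDl expR_ge0.
by rewrite ltr0_norm// mulrN -mulNr lerDr expR_ge0.
Qed.

(** The bound [y `^ (c - 1) <= y `^ (c0 - 1) + y `^ (c1 - 1)] makes the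
    domination uniform for [c] in a compact subset of the positive half-line;
    the logarithms cost an arbitrarily small power of [y] at both ends. *)
Lemma gamma_kernel_dominated i c0 c1 al : 0 < c0 -> 0 < al ->
  exists D : R -> R, [/\ mu.-integrable `]0, +oo[ (EFin \o D),
    forall y, 0 <= D y &
    forall c y, c0 <= c -> c <= c1 -> 0 < y ->
      `|ln y| ^+ i * y `^ (c - 1) * expR (- (al * y)) <= D y].
Proof.
move=> c00 al0; have d0 : 0 < c0 / 2 by rewrite divr_gt0.
have [K K0 hK] := ln_pow_le i d0; set d := c0 / 2 in d0 hK.
pose t c y : R := y `^ (c - 1) * expR (- (al * y)).
have tge c y : 0 <= t c y by rewrite mulr_ge0 ?powR_ge0 ?expR_ge0.
pose c2 := Num.max c0 c1; have c02 : c0 <= c2 by rewrite le_max lexx.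
pose D y := K * (t (c0 + d) y + t (c2 + d) y + (t (c0 - d) y + t (c2 - d) y)).
exists D; split.
- have it c : 0 < c -> mu.-integrable `]0, +oo[ (EFin \o t c).
    by move=> c_gt0; exact: integrable_powR_exp.
  have p1 : 0 < c0 + d by lra.
  have p2 : 0 < c2 + d by lra.
  have p3 : 0 < c0 - d by rewrite /d; lra.
  have p4 : 0 < c2 - d by rewrite /d; lra.
  apply: integrable_realZ => //; apply: integrable_realD => //.
    by apply: integrable_realD => //; exact: it.
  by apply: integrable_realD => //; exact: it.
- by move=> y; rewrite mulr_ge0// !addr_ge0.
- move=> c y c0c cc1 y0.
  have pc : y `^ (c - 1) <= y `^ (c0 - 1) + y `^ (c2 - 1).
    have cc2 : c <= c2 by rewrite le_max cc1 orbT.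
    rewrite /powR gt_eqF//; have [l0|l0] := leP 0 (ln y).
      apply: (@le_trans _ _ (expR ((c2 - 1) * ln y))); last by rewrite lerDr expR_ge0.
      by rewrite ler_expR ler_wpM2r// lerB.
    apply: (@le_trans _ _ (expR ((c0 - 1) * ln y))); last by rewrite lerDl expR_ge0.
    by rewrite ler_expR ler_wnM2r ?(ltW l0)// lerB.
  have tE e c' : t (c' + e) y = y `^ e * y `^ (c' - 1) * expR (- (al * y)).
    rewrite /t -powRD; last by rewrite (gt_eqF y0) implybT.
    by congr (_ `^ _ * _); ring.
  rewrite /D !tE; have := hK y y0.
  have := expR_ge0 (- (al * y)); have := powR_ge0 y d; have := powR_ge0 y (- d).
  move: (powR_ge0 y (c0 - 1)) (powR_ge0 y (c2 - 1)) (powR_ge0 y (c - 1)) pc.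
  move: (y `^ (c0 - 1)) (y `^ (c2 - 1)) (y `^ (c - 1)) => x0 x1 x.
  move: (y `^ d) (y `^ (- d)) (expR _) => u v e x0g x1g xg xx vg ug eg lK.
  rewrite !mulrDr !mulrA -!mulrDl ler_wpM2r//.
  apply: (@le_trans _ _ (K * (u + v) * x)); first by rewrite ler_wpM2r.
  apply: (@le_trans _ _ (K * (u + v) * (x0 + x1))).
    by rewrite ler_wpM2l// mulr_ge0// addr_ge0.
  by rewrite le_eqVlt; apply/orP; left; apply/eqP; ring.
Qed.

End gamma_kernel.

Section moment.
Context {R : realType}.
Notation mu := (@lebesgue_measure R).
Implicit Types (w : R -> R) (al a b c y C : R) (i k : nat).

(** Differentiating in the shape parameter [a] only multiplies by [ln y], so the
    terms with all [i] form a family closed under differentiation. *)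
Definition mterm w al i a y :=
  w y * ln y ^+ i * y `^ (a - 1) * expR (- (al * y)).

Definition moment w al i a := \int[mu]_(y in `]0, +oo[) mterm w al i a y.

Lemma mtermS w al i a y : mterm w al i.+1 a y = ln y * mterm w al i a y.
Proof. by rewrite /mterm exprS; ring. Qed.

Lemma is_derive_mterm w al i a y : 0 < y ->
  is_derive a 1 (fun a => mterm w al i a y) (mterm w al i.+1 a y).
Proof.
move=> y0; rewrite mtermS.
have E : (fun a => mterm w al i a y) =
    (fun a => (w y * ln y ^+ i * expR (- (al * y)) * expR (- ln y)) *
      expR (ln y * a + 0)).
  apply/funext => {}a; rewrite /mterm /powR gt_eqF// mulrDl mulN1r expRD.
  by rewrite addr0 [a * _]mulrC; ring.
rewrite E; set c := w y * _ * _ * _.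
have dE := @is_derive_affine _ expR (ln y) 0 a _ (is_derive_expR _).
have := is_deriveM (is_derive_cst c a (1 : R)) dE.
rewrite /GRing.scale/= => H; apply: (is_derive_eq H).
by rewrite (congr1 (@^~ a) E) mulr0 addr0 mulrCA.
Qed.

Section bounded_weight.
Variables (w : R -> R) (al b C : R).
Hypotheses (al0 : 0 < al) (mw : measurable_fun (`]0, +oo[%classic : set R) w) (C0 : 0 <= C).
Hypothesis wC : forall y, 0 < y -> `|w y| <= C * y `^ b.

Lemma measurable_mterm i a : measurable_fun (`]0, +oo[%classic : set R) (mterm w al i a).
Proof.
apply: measurable_funM.
  apply: measurable_funM; last exact: measurable_funS (measurable_powR _).
  apply: measurable_funM => //; apply: measurable_funX.
  exact (measurable_funTS (@measurable_ln R)).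
by apply: measurableT_comp => //; apply: measurableT_comp.
Qed.

Lemma mterm_dominated i c0 c1 : - b < c0 ->
  exists D : R -> R, [/\ mu.-integrable `]0, +oo[ (EFin \o D),
    forall y, 0 <= D y &
    forall a y, c0 <= a -> a <= c1 -> 0 < y -> `|mterm w al i a y| <= D y].
Proof.
move=> bc0; have cb0 : 0 < c0 + b by lra.
have [D [iD D0 hD]] := gamma_kernel_dominated i (c1 + b) cb0 al0.
exists (fun y => C * D y); split.
- exact: integrable_realZ.
- by move=> y; exact: mulr_ge0.
move=> a y c0a ac1 y0.
have := hD (a + b) y; rewrite !lerD2r => /(_ c0a ac1 y0) H.
rewrite /mterm !normrM normrX (ger0_norm (powR_ge0 _ _)) (ger0_norm (expR_ge0 _)).
apply: (le_trans _ (ler_wpM2l C0 H)).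
have -> : y `^ (a + b - 1) = y `^ b * y `^ (a - 1).
  rewrite -powRD; last by rewrite (gt_eqF y0) implybT.
  by congr (_ `^ _); ring.
have -> : C * (`|ln y| ^+ i * (y `^ b * y `^ (a - 1)) * expR (- (al * y))) =
   C * y `^ b * `|ln y| ^+ i * y `^ (a - 1) * expR (- (al * y)) by ring.
rewrite ler_wpM2r ?expR_ge0// ler_wpM2r ?powR_ge0// ler_wpM2r ?exprn_ge0//.
exact: wC.
Qed.

Lemma integrable_mterm i a : - b < a ->
  mu.-integrable `]0, +oo[ (EFin \o mterm w al i a).
Proof.
move=> ba; have [D [iD _ hD]] := mterm_dominated i a ba.
apply: le_integrable_real iD => //; first exact: measurable_mterm.
by move=> y; rewrite /= in_itv/= andbT => y0; exact: hD.
Qed.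

Lemma is_derive_moment i a : - b < a ->
  is_derive a 1 (moment w al i) (moment w al i.+1 a).
Proof.
move=> ba; pose u := (a - b) / 2; have bu : - b < u by rewrite /u; lra.
have Ia : [set` `]u, a + 1[ ] a by rewrite /= in_itv/= /u; lra.
have [D [iD D0 hD]] := mterm_dominated i.+1 (a + 1) bu.
have d1E x y : 0 < y -> partial1of2 (mterm w al i) x y = mterm w al i.+1 x y.
  by move=> y0; have /is_derive_derive1[] := is_derive_mterm w al i x y0.
have H1 x : [set` `]u, a + 1[ ] x ->
    mu.-integrable `]0, +oo[ (EFin \o mterm w al i x).
  rewrite /= in_itv/= => /andP[ux _].
  by apply: integrable_mterm; exact: lt_trans ux.
have H2 x y : [set` `]u, a + 1[ ] x -> [set` `]0%R, +oo[ ] y ->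
    derivable (fun a => mterm w al i a y) x 1.
  rewrite /= !in_itv/= andbT => _ y0.
  by have /is_derive_derive1[] := is_derive_mterm w al i x y0.
have H3 x y : [set` `]u, a + 1[ ] x -> [set` `]0%R, +oo[ ] y ->
    `|partial1of2 (mterm w al i) x y| <= D y.
  rewrite /= !in_itv/= andbT => /andP[ux xa] y0.
  by rewrite d1E//; apply: hD => //; exact: ltW.
have dM := @derivable_under_integral _ _ _ mu _ _ (measurable_itv `]0, +oo[)
  _ _ _ Ia H1 H2 _ D0 iD H3.
have eM := @differentiation_under_integral _ _ _ mu _ _
  (measurable_itv `]0, +oo[) _ _ _ Ia H1 H2 _ D0 iD H3.
have := derivable_is_derive1 dM; rewrite eM => H; apply: (is_derive_eq H).
apply: eq_Rintegral => y; rewrite inE /= in_itv/= andbT => y0; exact: d1E.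
Qed.

(** A weight of order [y `^ b] at [0] compensates the singularity of the kernel, whence
    smoothness beyond the domain [0 < a] of the Gamma integral. *)
Lemma smooth_moment i : smooth (- b) (moment w al i).
Proof.
move=> k; elim: k i => [|k IH] i; first exact: smooth_upto0.
by apply: (smooth_uptoS _ (IH i.+1)) => x bx; exact: is_derive_moment.
Qed.

End bounded_weight.

(** * Euler's Gamma function *)

Lemma Gamma_moment a : Gamma a = moment (cst 1) 1 0 a.
Proof.
by apply: eq_Rintegral => y _; rewrite /mterm/= expr0 !mul1r.
Qed.

Let cst1_bound y : 0 < y -> `|cst (1 : R) y| <= 1 * y `^ 0.
Proof. by move=> _; rewrite powRr0 mulr1 /= normr1. Qed.

Lemma smooth_Gamma : smooth (0 : R) Gamma.
Proof.
apply: eq_smooth (fun y _ => esym (Gamma_moment y)) _.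
by have := smooth_moment ltr01 (measurable_cst _) ler01 cst1_bound (i := 0);
  rewrite oppr0.
Qed.

Lemma integrable_Gamma a : 0 < a ->
  mu.-integrable `]0, +oo[ (EFin \o (fun s => s `^ (a - 1) * expR (- s))).
Proof.
move=> a0; have a0' : - 0 < a by rewrite oppr0.
apply: eq_integrable_real (integrable_mterm ltr01 _ ler01 cst1_bound 0 a0') => //.
by move=> y _; rewrite /mterm/= expr0 !mul1r.
Qed.

(** Integration by parts: [s `^ a * expR (- s)] vanishes at both ends. *)
Lemma GammaS a : 0 < a -> Gamma (a + 1) = a * Gamma a.
Proof.
move=> a0; have a10 : 0 < a + 1 by rewrite addr_gt0.
pose F s : R := s `^ a * expR (- 1 * s).
pose f s : R :=
  a * (s `^ (a - 1) * expR (- 1 * s)) - s `^ a * expR (- 1 * s).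
have ig := integrable_Gamma a0; have ig1 := integrable_Gamma a10.
have fE : f = (fun s => a * (s `^ (a - 1) * expR (- s)) +
    -1 * (s `^ (a + 1 - 1) * expR (- s))).
  by apply/funext => s; rewrite /f addrK !mulN1r.
have intf : mu.-integrable `]0, +oo[ (EFin \o f).
  by rewrite fE; apply: integrable_realD => //; exact: integrable_realZ.
suff : \int[mu]_(s in `]0, +oo[) f s = 0.
  rewrite fE RintegralD//; do ?exact: integrable_realZ.
  by rewrite !RintegralZl// mulN1r => /eqP; rewrite subr_eq0 => /eqP.
apply: (@exhaustion_FTC _ (fun k => k.+2%:R^-1) (fun k => k.+2%:R) _ f F) => //.
- move=> k; rewrite (@lt_trans _ _ 1)//; last by rewrite ltr1n.
  by rewrite invf_lt1 ?ltr1n ?ltr0n.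
- by move=> k; rewrite lef_pV2 ?posrE ?ltr0n// ler_nat.
- by move=> k; rewrite ler_nat.
- exact: itv0y_exhaust.
- move=> y; rewrite /= in_itv/= andbT => y0.
  apply: (@smooth_continuous _ 0) => //; rewrite /f.
  have sN := @smooth_expRM _ (0 : R) (- 1).
  have s1 c := smoothM (@smooth_powR _ c) sN.
  exact: smoothB (@smoothMl _ _ a _ (s1 _)) (s1 _).
- move=> y; rewrite /= in_itv/= andbT => y0.
  have d1 := is_derive1_powR a y0.
  have d2 := is_derive_expRM (- 1) y.
  have := is_deriveM d1 d2; rewrite /GRing.scale/= => d3.
  by apply: (is_derive_eq d3); rewrite /f; ring.
- rewrite -(subr0 0); apply: cvgB.
    have [K K0 hK] := powR_expN_bounded a10 ltr01.
    have : (K * k.+2%:R^-1 `^ 1 : R) @[k --> \oo] --> (0 : R).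
      rewrite -[X in _ --> X](mulr0 K); apply: cvgM; first exact: cvg_cst.
      exact: cvg_invSS_powR.
    apply: squeeze_cvgr (cvg_cst 0); apply: nearW => k.
    have k0 : 0 < k.+2%:R :> R by rewrite ltr0n.
    rewrite /F mulr_ge0 ?powR_ge0 ?expR_ge0//=.
    rewrite powRr1 ?invr_ge0 ?ler0n// ler_pdivlMr//.
    rewrite (le_trans _ (hK _ k0))// mul1r mulN1r powRD; last first.
      by rewrite pnatr_eq0 implybT.
    by rewrite powRr1 ?ler0n// mulrAC.
  apply: squeeze_cvgr (cvg_cst 0) (cvg_invSS_powR a0); apply: nearW => k.
  rewrite /F mulr_ge0 ?powR_ge0 ?expR_ge0//= ler_piMr ?powR_ge0//.
Qed.

(** Already the integral over [[1, 2]] is that large. *)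
Lemma Gamma_ge a : 1 <= a -> expR (- 2%:R) <= Gamma a.
Proof.
move=> a1; have a0 : 0 < a by lra.
have ig := integrable_Gamma a0.
have sub12 : [set` `[1%R, 2%R : R]] `<=` [set` `]0%R, +oo[].
  by move=> y /=; rewrite !in_itv/= andbT => /andP[y1 _]; lra.
have ig12 : mu.-integrable `[1%R, 2%R]
    (EFin \o (fun s => s `^ (a - 1) * expR (- s))).
  exact: integrableS ig.
have hb y : [set` `[1%R, 2%R : R]] y ->
    expR (- 2%:R) <= y `^ (a - 1) * expR (- y).
  rewrite /= in_itv/= => /andP[y1 y2].
  apply: (@le_trans _ _ (1 * expR (- y))); first by rewrite mul1r ler_expR lerN2.
  by rewrite ler_wpM2r ?expR_ge0// -[leLHS](powRr0 y) ler_powR// subr_ge0.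
have ic : mu.-integrable `[1%R, 2%R] (EFin \o (fun=> expR (- 2%:R))).
  apply: le_integrable_real ig12 => // y /hb.
  by rewrite ger0_norm ?expR_ge0.
apply: (@le_trans _ _ (\int[mu]_(s in `[1%R, 2%R]) (s `^ (a - 1) * expR (- s)))).
  apply: le_trans (le_Rintegral _ ic ig12 hb) => //.
  rewrite Rintegral_cst// ler_peMr ?expR_ge0//.
  have -> : fine (mu `[1%R, 2%R]) = 2 - 1.
    by rewrite lebesgue_measure_itv/= lte_fin ltr1n.
  lra.
rewrite /Gamma /Rintegral fine_le//; do ?exact: integrable_fin_num.
apply: ge0_subset_integral => //.
  by apply/measurable_EFinP; exact: integrable_real_measurable ig.
by move=> y _; rewrite lee_fin mulr_ge0 ?powR_ge0 ?expR_ge0.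
Qed.

Lemma Gamma_gt0 a : 0 < a -> 0 < Gamma a.
Proof.
move=> a0; rewrite -(pmulr_rgt0 _ a0) -GammaS//.
by rewrite (lt_le_trans (expR_gt0 (- 2)))// Gamma_ge// lerDr ltW.
Qed.

(** The total mass of the exponential distribution. *)
Lemma Gamma1 : Gamma 1 = 1 :> R.
Proof.
have := integral_exponential_pdf (@ltr01 R).
rewrite /exponential_pdf => E.
have i1 := integrable_Gamma (@ltr01 R).
rewrite /Gamma Rintegral_itv_obnd_cbnd//.
suff -> : \int[mu]_(s in `[0%R, +oo[) (s `^ (1 - 1) * expR (- s)) =
    fine (\int[mu]_x ((fun x => 1 * expR (- 1 * x)) \_ `[0%R, +oo[ x)%:E)%E.
  by rewrite E.
rewrite /Rintegral integral_mkcond; congr fine; apply: eq_integral => y _.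
by rewrite !patchE; case: ifPn => // _; rewrite subrr powRr0 mulN1r.
Qed.

End moment.

(** * The Abel kernel *)

Section abel.
Context {R : realType}.
Notation mu := (@lebesgue_measure R).
Implicit Types (m t e : R) (f g : R -> R).

(** Up to the factor [(Gamma (1 - m))^-1], the Riemann-Liouville integral of
    order [1 - m]. *)
Definition abel m f t := \int[mu]_(s in `[0, t]) (f s / (t - s) `^ m).

Lemma integrable_itv_oo_cc a b f : mu.-integrable `]a, b[ (EFin \o f) ->
  mu.-integrable `[a, b] (EFin \o f).
Proof.
move=> /integrableP[mf fi]; apply/integrableP; split.
  exact: (@emeasurable_fun_itv_cc R a b false true _ mf).
have mfa : measurable_fun `]a, b[ (abse \o (EFin \o f)) by exact: measurableT_comp.
rewrite -integral_itv_bndo_bndc; last first.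
  exact/emeasurable_fun_itv_obnd_cbndP.
by rewrite -integral_itv_obnd_cbnd.
Qed.

Lemma Rintegral_itv_oo_cc a b f : mu.-integrable `]a, b[ (EFin \o f) ->
  \int[mu]_(x in `[a, b]) f x = \int[mu]_(x in `]a, b[) f x.
Proof.
move=> fi; rewrite Rintegral_itv_obnd_cbnd// Rintegral_itv_bndo_bndc//.
apply: integrableS (integrable_itv_oo_cc fi) => //.
by move=> x /=; rewrite !in_itv/= => /andP[-> /ltW].
Qed.

(* The shift by [3] keeps the two end points of the segments below apart. *)
Lemma cvg_invSSS : (k.+3%:R^-1 : R) @[k --> \oo] --> (0 : R).
Proof.
have := @cvg_harmonic R; rewrite -(cvg_shiftn 2); apply: cvg_trans.
by apply: near_eq_cvg; apply: nearW => k; rewrite /harmonic/= addn2.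
Qed.

Section exhaust_0t.
Variable t : R.
Hypothesis t0 : 0 < t.
Let a k : R := t * k.+3%:R^-1.
Let b k : R := t - t * k.+3%:R^-1.

Lemma exhaust_0t_lt k : a k < b k.
Proof.
have : (k.+3%:R^-1 : R) < 2^-1 by rewrite ltf_pV2 ?posrE ?ltr0n// ltr_nat.
by rewrite /a /b; move: (_^-1) => x; rewrite -(ltr_pM2l t0); lra.
Qed.

Lemma exhaust_0t_decr k : a k.+1 <= a k.
Proof. by rewrite ler_pM2l// lef_pV2 ?posrE ?ltr0n// ler_nat. Qed.

Lemma exhaust_0t_incr k : b k <= b k.+1.
Proof. by rewrite lerB// exhaust_0t_decr. Qed.

Lemma exhaust_0t : [set` `]0, t[] = \bigcup_k [set` `[a k, b k]].
Proof.
have a0 k : 0 < a k by rewrite mulr_gt0// invr_gt0 ltr0n.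
apply/seteqP; split => [y|y [k _]] /=; rewrite !in_itv/=; last first.
  move=> /andP[ky yk]; rewrite (lt_le_trans (a0 k) ky) (le_lt_trans yk)//.
  by rewrite ltrBlDr ltrDl a0.
move=> /andP[y0 yt].
have cva : a k @[k --> \oo] --> (0 : R).
  by rewrite -(mulr0 t); apply: cvgM; [exact: cvg_cst|exact: cvg_invSSS].
have [m _ hm] := cvgr_lt _ cva _ y0.
have ty0 : 0 < t - y by rewrite subr_gt0.
have [k _ hk] := cvgr_lt _ cva _ ty0.
exists (maxn m k) => //=; rewrite in_itv/=; apply/andP; split.
  by apply: ltW; apply: hm => /=; exact: leq_maxl.
rewrite lerBrDr -lerBrDl; apply: ltW; apply: hk => /=; exact: leq_maxr.
Qed.

Lemma cvg_exhaust_0t_l : a k @[k --> \oo] --> (0 : R).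
Proof. by rewrite -(mulr0 t); apply: cvgM; [exact: cvg_cst|exact: cvg_invSSS]. Qed.

Lemma cvg_exhaust_0t_r : b k @[k --> \oo] --> (t : R).
Proof.
by rewrite -[X in _ --> X]subr0; apply: cvgB; [exact: cvg_cst|exact: cvg_exhaust_0t_l].
Qed.

Lemma exhaust_0t_gt0 k : 0 < a k.
Proof. by rewrite mulr_gt0// invr_gt0 ltr0n. Qed.

End exhaust_0t.

Lemma cvg_powR_seq m (u : R^nat) : 0 < m -> (forall k, 0 < u k) ->
  u k @[k --> \oo] --> (0 : R) -> u k `^ m @[k --> \oo] --> (0 : R).
Proof.
move=> m0 u0 cu; apply: (@cvg_comp _ _ _ u (fun x => x `^ m)
  _ (0^'+) _ _ (powR_cvg0 m0)).
move=> A [e /= e0 eA]; move/cvgr0_norm_lt: cu => /(_ _ e0).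
by apply: filterS => k uk; apply: eA => //=; rewrite sub0r normrN.
Qed.

Lemma is_derive_abel_kernel r t x : x < t ->
  is_derive x (1 : R) (fun s => (t - s) `^ r) (- r * (t - x) `^ (r - 1)).
Proof.
move=> xt; have -> : (fun s => (t - s) `^ r) = (fun s => (-1 * s + t) `^ r).
  by apply/funext => s; rewrite mulN1r addrC.
have tx0 : 0 < -1 * x + t by rewrite mulN1r addrC subr_gt0.
have d := @is_derive_affine _ (fun x => x `^ r) (-1) t x _ (is_derive1_powR r tx0).
apply: (is_derive_eq d); have -> : -1 * x + t = t - x by ring.
by ring.
Qed.

Lemma abel_kernel_continuous r t x : x < t ->
  {for x, continuous (fun s : R => (t - s) `^ r)}.
Proof.
move=> xt; apply/differentiable_continuous/derivable1_diffP.
by have [] := is_derive_abel_kernel r xt.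
Qed.

Lemma integrable_abel_kernel m t : m < 1 -> 0 < t ->
  mu.-integrable `]0, t[ (EFin \o (fun s => (t - s) `^ (- m))).
Proof.
move=> m1 t0; have m10 : 0 < 1 - m by rewrite subr_gt0.
pose F s : R := (- (1 - m)^-1) * (t - s) `^ (1 - m).
apply: (@exhaustion_integrable _ _ _ _ _ F ((1 - m)^-1 * t `^ (1 - m))
  (exhaust_0t_lt t0) (exhaust_0t_decr t0) (exhaust_0t_incr t0) (exhaust_0t t0)).
- move=> x; rewrite /= in_itv/= => /andP[_ xt].
  exact: abel_kernel_continuous.
- move=> x; rewrite /= in_itv/= => /andP[_ xt].
  have := is_deriveM (is_derive_cst (- (1 - m)^-1) x (1 : R))
    (is_derive_abel_kernel (1 - m) xt).
  rewrite /GRing.scale/= => d; apply: (is_derive_eq d).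
  rewrite mulr0 addr0 mulrA mulrNN mulVf ?gt_eqF// mul1r; congr (_ `^ _); ring.
- have F0 : F 0 = - ((1 - m)^-1 * t `^ (1 - m)) by rewrite /F subr0 mulNr.
  have -> : (1 - m)^-1 * t `^ (1 - m) = 0 - F 0 by rewrite F0 sub0r opprK.
  apply: cvgB.
    rewrite /F -[X in _ --> X](mulr0 (- (1 - m)^-1)); apply: cvgM.
      exact: cvg_cst.
    apply: cvg_powR_seq => //.
      by move=> k; rewrite subKr exhaust_0t_gt0.
    under eq_fun do rewrite subKr; exact: cvg_exhaust_0t_l.
  apply: (@cvg_comp _ _ _ _ F _ _ _ (cvg_exhaust_0t_l t)).
  by apply: cvgM; [exact: cvg_cst|exact: (@abel_kernel_continuous (1 - m) t 0 t0)].
- by move=> x _; exact: powR_ge0.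
Qed.

Lemma abel_kernelE f m t :
  (fun s => f s / (t - s) `^ m) = (fun s => f s * (t - s) `^ (- m)).
Proof. by apply/funext => s; rewrite powRN. Qed.

(** [M] only bounds [f] on the open interval: the integrand may take any value
    at the end points. *)
Lemma integrable_abel m f t M : m < 1 -> 0 < t ->
  measurable_fun (`]0, t[%classic : set R) f ->
  (forall s, 0 < s -> s < t -> `|f s| <= M) ->
  mu.-integrable `]0, t[ (EFin \o (fun s => f s / (t - s) `^ m)).
Proof.
move=> m1 t0 mf fM; rewrite abel_kernelE.
apply: le_integrable_real (integrable_realZ _ M (integrable_abel_kernel m1 t0)) => //.
  apply: measurable_funM => //.
  exact: integrable_real_measurable (integrable_abel_kernel m1 t0).
move=> s; rewrite /= in_itv/= => /andP[s0 st].
rewrite normrM (ger0_norm (powR_ge0 _ _)) ler_wpM2r ?powR_ge0//.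
exact: fM.
Qed.

Let scale t (x : measurableTypeR R) : measurableTypeR R := t * x.

Let measurable_scale t : measurable_fun [set: measurableTypeR R] (scale t).
Proof. exact: measurable_funM. Qed.

(** By uniqueness of the Lebesgue measure, checked on half-open intervals. *)
Lemma lebesgue_measure_scale t (t0 : 0 < t) (A : set R) : measurable A ->
  mu A = pushforward (mscale (NngNum (ltW t0)) mu) (scale t) A.
Proof.
move=> mA; apply: lebesgue_measure_unique => //=.
move=> _ [[a b]] _ <-; rewrite /pushforward /mscale/=.
have -> : scale t @^-1` `]a, b] = [set` `]a / t, b / t]].
  by apply/seteqP; split => x /=; rewrite !in_itv/= ltr_pdivrMr// ler_pdivlMr//
    ![x * t]mulrC.
rewrite !lebesgue_measure_itv/= !lte_fin ltr_pM2r ?invr_gt0//.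
case: ifP => _; last by rewrite mule0.
by rewrite -EFinD -EFinM -mulrBl mulrCA divff ?gt_eqF// mulr1.
Qed.

Lemma ge0_integral_scale t (f : R -> \bar R) : 0 < t ->
  measurable_fun (`[0, t]%classic : set R) f ->
  (forall x, [set` `[0, t]] x -> (0 <= f x)%E) ->
  (\int[mu]_(x in `[0%R, t]) f x = t%:E * \int[mu]_(x in `[0%R, 1%R]) f (t * x)%R)%E.
Proof.
move=> t0 mf f0.
have E : scale t @^-1` `[0, t] = [set` `[0, 1]].
  have tx x : (t * x <= t) = (x <= 1) by rewrite -[X in _ <= X]mulr1 ler_pM2l.
  by apply/seteqP; split => x /=; rewrite !in_itv/= pmulr_rge0// tx.
pose k : {nonneg R} := NngNum (ltW t0).
transitivity (\int[pushforward (mscale k mu) (scale t)]_(x in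
    `[0%R, t]) f x)%E.
  by apply: eq_measure_integral => A mA _; exact: lebesgue_measure_scale.
rewrite ge0_integral_pushforward//; last first.
  by move=> x /set_mem; exact: f0.
rewrite E ge0_integral_mscale//=.
- apply: (measurable_comp (F := [set` `[0, t]])) => //.
    by rewrite -E => _ [x + <-].
  exact: measurable_funTS (measurable_scale t).
- by move=> x; rewrite inE => x01; apply: f0; have : (scale t @^-1` `[0, t]) x
    by rewrite E.
Qed.

Lemma integrable_scale t f : 0 < t -> mu.-integrable `[0, t] (EFin \o f) ->
  mu.-integrable `[0, 1] (EFin \o (fun x => f (t * x))).
Proof.
move=> t0 /integrableP[mf fi].
have E : scale t @^-1` `[0, t] = [set` `[0, 1]].
  have tx x : (t * x <= t) = (x <= 1) by rewrite -[X in _ <= X]mulr1 ler_pM2l.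
  by apply/seteqP; split => x /=; rewrite !in_itv/= pmulr_rge0// tx.
apply/integrableP; split.
  have -> : EFin \o (fun x => f (t * x)) = (EFin \o f) \o scale t by [].
  apply: (measurable_comp (F := [set` `[0, t]])) => //.
    by rewrite -E => _ [x + <-].
  exact: measurable_funTS (measurable_scale t).
move: fi; rewrite (@ge0_integral_scale t (fun x => `|(EFin \o f) x|%E))//; last first.
  exact: measurableT_comp.
set I := integral _ _ _; have : (0 <= I)%E by exact: integral_ge0.
by case: I => [r| |]//; rewrite ?ltry// mulry gtr0_sg// mul1e.
Qed.

(** Stretching to the fixed domain [[0, 1]] is what makes an integral with a
    moving end point and a singular kernel differentiable in [t]. *)
Lemma Rintegral_scale t f : 0 < t -> mu.-integrable `[0, t] (EFin \o f) ->
  \int[mu]_(x in `[0, t]) f x = t * \int[mu]_(x in `[0, 1]) f (t * x).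
Proof.
move=> t0 fi; have fi' := integrable_scale t0 fi.
have [mf _] := integrableP _ _ _ fi.
pose g := EFin \o (fun x => f (t * x)).
have Af : (\int[mu]_(x in `[0%R, 1%R]) g^\+ x)%E \is a fin_num.
  by apply: integrable_pos_fin_num => //; exact: fi'.
have Bf : (\int[mu]_(x in `[0%R, 1%R]) g^\- x)%E \is a fin_num.
  by apply: integrable_neg_fin_num => //; exact: fi'.
rewrite /Rintegral integralE ge0_integral_scale//; last exact: measurable_funepos.
rewrite [X in (_ - X)%E]ge0_integral_scale//; last exact: measurable_funeneg.
rewrite [in RHS]integralE -(fineK Af) -(fineK Bf) /= mulrBr.
have EA : (\int[mu]_(x in `[0%R, 1%R]) ((EFin \o f)^\+ (t * x)%R) =
    (fine (\int[mu]_(x in `[0%R, 1%R]) (g^\+ x)))%:E)%E.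
  by rewrite fineK//; apply: eq_integral => x _; rewrite !funeposE.
have EB : (\int[mu]_(x in `[0%R, 1%R]) ((EFin \o f)^\- (t * x)%R) =
    (fine (\int[mu]_(x in `[0%R, 1%R]) (g^\- x)))%:E)%E.
  by rewrite fineK//; apply: eq_integral => x _; rewrite !funenegE.
by rewrite EA EB.
Qed.

End abel.

(** * Differentiating the Abel integral *)

Section abel_derivative.
Context {R : realType}.
Notation mu := (@lebesgue_measure R).
Implicit Types (m t e x : R) (f g : R -> R).

(** Smoothness on a neighbourhood of [0] gives control on closed segments
    starting at [0]. *)
Lemma smooth_bounded e f t : 0 < e -> smooth (- e) f -> 0 <= t ->
  exists2 M, 0 <= M & forall s, 0 <= s -> s <= t -> `|f s| <= M.
Proof.
move=> e0 sf t0.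
have cf : {within `[0, t], continuous (fun s => `|f s|)}.
  apply: continuous_in_subspaceT => s; rewrite inE/= in_itv/= => /andP[s0 _].
  have es : - e < s by rewrite (lt_le_trans _ s0)// oppr_lt0.
  apply: (@cvg_comp _ _ _ f (fun x => `|x|) _ (nbhs (f s))).
    exact: smooth_continuous sf es.
  exact: norm_continuous.
have [c _ hc] := EVT_max t0 cf.
exists `|f c| => // s s0 st; apply: hc; rewrite in_itv/= s0; exact: st.
Qed.

Lemma smooth_measurable e f (A : set R) : 0 < e -> smooth (- e) f ->
  measurable A -> A `<=` [set` `]0, +oo[] -> measurable_fun A f.
Proof.
move=> e0 sf mA A0; apply: (measurable_funS (E := [set` `]- e, +oo[])) => //.
  by move=> x /A0 /=; rewrite !in_itv/= !andbT; apply: lt_trans; rewrite oppr_lt0.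
apply: open_continuous_measurable_fun => // x; rewrite inE/= in_itv/= andbT.
exact: smooth_continuous.
Qed.

Lemma smooth_stretch e f t : 0 < e -> smooth (- e) f -> 0 < t ->
  smooth (- (e / t)) (fun x => f (t * x)).
Proof.
move=> e0 sf t0.
have -> : (fun x => f (t * x)) = (fun x => f (t * x + 0)).
  by apply/funext => x; rewrite addr0.
apply: smooth_affine sf => x; rewrite addr0 -mulNr ltr_pdivrMr//.
by rewrite mulrC.
Qed.

Lemma integrable_abel_smooth e f m t : 0 < e -> smooth (- e) f -> m < 1 ->
  0 < t -> mu.-integrable `]0, t[ (EFin \o (fun s => f s * (t - s) `^ (- m))).
Proof.
move=> e0 sf m1 t0; have [M M0 hM] := smooth_bounded e0 sf (ltW t0).
rewrite -abel_kernelE; apply: (@integrable_abel _ m f t M m1 t0).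
  by apply: smooth_measurable e0 sf _ _ => // x /=; rewrite !in_itv/= => /andP[->].
by move=> s s0 st; apply: hM; exact: ltW.
Qed.

Lemma abel_stretch e f m t : 0 < e -> smooth (- e) f -> m < 1 -> 0 < t ->
  abel m f t =
  t `^ (1 - m) * \int[mu]_(x in `]0, 1[) (f (t * x) * (1 - x) `^ (- m)).
Proof.
move=> e0 sf m1 t0; have e0' : 0 < e / t by rewrite divr_gt0.
have i1 := integrable_abel_smooth e0' (smooth_stretch e0 sf t0) m1 ltr01.
have i2 := integrable_itv_oo_cc (integrable_abel_smooth e0 sf m1 t0).
rewrite /abel abel_kernelE (Rintegral_scale t0 i2).
rewrite -(Rintegral_itv_oo_cc i1).
have -> : t `^ (1 - m) = t * t `^ (- m).
  by rewrite powRD ?powRr1 ?(ltW t0)// (gt_eqF t0) implybT.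
rewrite -mulrA; congr (_ * _).
rewrite -RintegralZl; [|exact: measurable_itv|exact: integrable_itv_oo_cc].
apply: eq_Rintegral => x; rewrite inE/= in_itv/= => /andP[x0 x1].
have -> : t - t * x = t * (1 - x) by ring.
by rewrite powRM ?(ltW t0) ?subr_ge0// mulrCA.
Qed.

Section derivative.
Variables (e m : R) (f : R -> R).
Hypotheses (e0 : 0 < e) (sf : smooth (- e) f) (m1 : m < 1).

Let A t := \int[mu]_(x in `]0, 1[) (f (t * x) * (1 - x) `^ (- m)).
Let sf' := smooth_derive1 sf.

Let is_derive_stretch t x : 0 < t -> 0 < x ->
  is_derive t 1 (fun t => f (t * x) * (1 - x) `^ (- m))
    (x * derive1 f (t * x) * (1 - x) `^ (- m)).
Proof.
move=> t0 x0.
have es : - e < x * t + 0.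
  by rewrite addr0 (lt_trans _ (mulr_gt0 x0 t0))// oppr_lt0.
have := is_derive_affine (smooth_is_derive sf es); rewrite addr0 => d1.
have := is_deriveM d1 (is_derive_cst ((1 - x) `^ (- m)) t 1).
have -> : (fun t => f (t * x) * (1 - x) `^ (- m)) =
    (fun y => f (x * y + 0)) * cst ((1 - x) `^ (- m)).
  apply/funext => y.
  change (f (y * x) * (1 - x) `^ (- m) = f (x * y + 0) * (1 - x) `^ (- m)).
  by rewrite addr0 [x * y]mulrC.
move=> d2; apply: (is_derive_eq d2).
rewrite /GRing.scale/= mulr0 add0r; have -> : t * x = x * t by ring.
by ring.
Qed.

(* The domain no longer depends on [t]: differentiation under the integral. *)
Let is_derive_A t : 0 < t -> is_derive t 1 A
  (\int[mu]_(x in `]0, 1[) (x * derive1 f (t * x) * (1 - x) `^ (- m))).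
Proof.
move=> t0.
have t20 : 0 <= t + 1 by rewrite addr_ge0// ltW.
have [M M0 hM] := smooth_bounded e0 sf' t20.
have It : [set` `](t / 2), (t + 1)[ ] t by rewrite /= in_itv/=; lra.
pose F t x := f (t * x) * (1 - x) `^ (- m).
have d1E y x : 0 < y -> 0 < x -> partial1of2 F y x =
    x * derive1 f (y * x) * (1 - x) `^ (- m).
  by move=> y0 x0; have /is_derive_derive1[] := is_derive_stretch y0 x0.
have H1 y : [set` `](t / 2), (t + 1)[ ] y -> mu.-integrable `]0, 1[ (EFin \o F y).
  rewrite /= in_itv/= => /andP[ty _]; have y0 : 0 < y by lra.
  have e0' : 0 < e / y by rewrite divr_gt0.
  exact: integrable_abel_smooth e0' (smooth_stretch e0 sf y0) m1 ltr01.
have H2 y x : [set` `](t / 2), (t + 1)[ ] y -> [set` `]0%R, 1%R[ ] x ->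
    derivable (F ^~ x) y 1.
  rewrite /= !in_itv/= => /andP[ty _] /andP[x0 _]; have y0 : 0 < y by lra.
  by have /is_derive_derive1[] := is_derive_stretch y0 x0.
have iG : mu.-integrable `]0, 1[ (EFin \o (fun x => M * (1 - x) `^ (- m))).
  by apply: integrable_realZ => //; exact: integrable_abel_kernel.
have G0 x : 0 <= M * (1 - x) `^ (- m) by rewrite mulr_ge0// powR_ge0.
have H3 y x : [set` `](t / 2), (t + 1)[ ] y -> [set` `]0%R, 1%R[ ] x ->
    `|partial1of2 F y x| <= M * (1 - x) `^ (- m).
  rewrite /= !in_itv/= => /andP[ty yt] /andP[x0 x1]; have y0 : 0 < y by lra.
  rewrite d1E// !normrM (ger0_norm (powR_ge0 _ _)) ler_wpM2r ?powR_ge0//.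
  rewrite (gtr0_norm x0) -[leRHS]mul1r ler_pM ?(ltW x0) ?(ltW x1)//.
  by apply: hM; [rewrite mulr_ge0 ?ltW|nra].
have dM := @derivable_under_integral _ _ _ mu _ _ (measurable_itv `]0, 1[)
  _ _ _ It H1 H2 _ G0 iG H3.
have eM := @differentiation_under_integral _ _ _ mu _ _
  (measurable_itv `]0, 1[) _ _ _ It H1 H2 _ G0 iG H3.
have := derivable_is_derive1 dM; rewrite eM => H; apply: (is_derive_eq H).
by apply: eq_Rintegral => x; rewrite inE /= in_itv/= => /andP[x0 _]; exact: d1E.
Qed.

(** Integration by parts: [(1 - x) `^ (1 - m)], a multiple of a primitive of the
    kernel, vanishes at [1]. *)
Let by_parts t : 0 < t ->
  t * \int[mu]_(x in `]0, 1[) (derive1 f (t * x) * (1 - x) `^ (1 - m)) =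
  (1 - m) * A t - f 0.
Proof.
move=> t0; have m10 : 0 < 1 - m by rewrite subr_gt0.
have et : 0 < e / t by rewrite divr_gt0.
have st := smooth_stretch e0 sf t0; have st' := smooth_stretch e0 sf' t0.
pose F x := f (t * x) * (1 - x) `^ (1 - m).
pose g x := t * (derive1 f (t * x) * (1 - x) `^ (1 - m)) +
  - (1 - m) * (f (t * x) * (1 - x) `^ (- m)).
have i1 : mu.-integrable `]0, 1[
    (EFin \o (fun x => derive1 f (t * x) * (1 - x) `^ (1 - m))).
  have -> : 1 - m = - (m - 1) by rewrite opprB.
  by apply: integrable_abel_smooth et st' _ ltr01; rewrite ltrBlDr (lt_trans m1)// ltrDl.
have i2 := integrable_abel_smooth et st m1 ltr01.
have ig : mu.-integrable `]0, 1[ (EFin \o g).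
  by apply: integrable_realD => //; exact: integrable_realZ.
suff : \int[mu]_(x in `]0, 1[) g x = - f 0.
  rewrite RintegralD//; [|exact: integrable_realZ|exact: integrable_realZ].
  by rewrite !RintegralZl// -/(A t); lra.
apply: (@exhaustion_FTC _ _ _ _ _ F _
  (exhaust_0t_lt ltr01) (exhaust_0t_decr ltr01) (exhaust_0t_incr ltr01)
  (exhaust_0t ltr01) _ _ _ ig).
- move=> x; rewrite /= in_itv/= => /andP[x0 x1].
  have ex : - (e / t) < x by rewrite (lt_trans _ x0)// oppr_lt0.
  have c1 r := @abel_kernel_continuous _ r 1 x x1.
  apply: cvgD; apply: cvgM; first exact: cvg_cst.
  + by apply: cvgM; [exact: smooth_continuous st' ex|exact: c1].
  + exact: cvg_cst.
  + by apply: cvgM; [exact: smooth_continuous st ex|exact: c1].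
- move=> x; rewrite /= in_itv/= => /andP[x0 x1].
  have es : - e < t * x + 0.
    by rewrite addr0 (lt_trans _ (mulr_gt0 t0 x0))// oppr_lt0.
  have d1 := is_derive_affine (smooth_is_derive sf es).
  have d2 := is_derive_abel_kernel (1 - m) x1.
  have d3 := is_deriveM d1 d2.
  have -> : F = (fun y => f (t * y + 0)) * (fun s => (1 - s) `^ (1 - m)).
    by apply/funext => y; rewrite /F; congr (f _ * _); rewrite addr0.
  apply: (is_derive_eq d3); rewrite /g addr0 /GRing.scale/=.
  have -> : 1 - m - 1 = - m by ring.
  by ring.
- have -> : - f 0 = f (t * 1) * 0 - F 0.
    by rewrite /F subr0 powR1 /= !mulr1 !mulr0 sub0r.
  apply: cvgB.
    apply: cvgM.
      apply: (@cvg_comp _ _ _ _ (fun x => f (t * x)) _ (nbhs (1 : R))).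
        exact: cvg_exhaust_0t_r.
      by apply: (smooth_continuous st); rewrite (lt_trans _ ltr01)// oppr_lt0.
    apply: cvg_powR_seq => //.
    have -> : (fun k : nat => 1 - (1 - 1 * k.+3%:R^-1)) =
        (fun k => 1 * k.+3%:R^-1 : R) by apply/funext => k; rewrite subKr.
    exact: cvg_exhaust_0t_l.
  apply: (@cvg_comp _ _ _ _ F _ (nbhs (0 : R))); first exact: cvg_exhaust_0t_l.
  apply: cvgM.
    by apply: (smooth_continuous st); rewrite oppr_lt0.
  exact: (@abel_kernel_continuous _ (1 - m) 1 0 ltr01).
Qed.

(** The derivative of the factor [t `^ (1 - m)] of the stretched integral brings in
    [(1 - m) * A t], which integration by parts turns into the boundary term [f 0]
    and an integral of the derivative of [f]. *)
Lemma is_derive_abel t : 0 < t ->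
  is_derive t 1 (abel m f) (f 0 * t `^ (- m) + abel m (derive1 f) t).
Proof.
move=> t0; have m10 : 0 < 1 - m by rewrite subr_gt0.
have et : 0 < e / t by rewrite divr_gt0.
have st' := smooth_stretch e0 sf' t0.
have d1 := is_derive1_powR (1 - m) t0.
have := is_deriveM d1 (is_derive_A t0); rewrite /GRing.scale/= => d.
apply: (@near_eq_is_derive _ _ _ (fun t => t `^ (1 - m) * A t)).
  apply: (@near_gt_eq _ 0) t0 => y y0.
  by rewrite (abel_stretch e0 sf m1 y0).
apply: (is_derive_eq d); rewrite (abel_stretch e0 sf' m1 t0).
have i1 : mu.-integrable `]0, 1[
    (EFin \o (fun x => derive1 f (t * x) * (1 - x) `^ (- m))).
  exact: integrable_abel_smooth et st' m1 ltr01.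
have ix : mu.-integrable `]0, 1[
    (EFin \o (fun x => x * derive1 f (t * x) * (1 - x) `^ (- m))).
  have sx : smooth (- (e / t)) (fun x => x * derive1 f (t * x)).
    exact: smoothM (@smooth_id _ _) st'.
  exact: integrable_abel_smooth et sx m1 ltr01.
have E : \int[mu]_(x in `]0, 1[) (derive1 f (t * x) * (1 - x) `^ (1 - m)) =
    \int[mu]_(x in `]0, 1[) (derive1 f (t * x) * (1 - x) `^ (- m)) -
    \int[mu]_(x in `]0, 1[) (x * derive1 f (t * x) * (1 - x) `^ (- m)).
  rewrite -RintegralB//; apply: eq_Rintegral => x.
  rewrite inE/= in_itv/= => /andP[x0 x1].
  rewrite powRD; last by rewrite (gt_eqF m10).
  by rewrite powRr1 ?subr_ge0 ?(ltW x1)//; ring.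
have := by_parts t0; rewrite E; move: (\int[mu]_(x in _) _) => I1.
move: (\int[mu]_(x in _) _) => I2 H.
have -> : 1 - m - 1 = - m by ring.
have -> : t `^ (1 - m) = t * t `^ (- m).
  by rewrite powRD ?powRr1 ?(ltW t0)// (gt_eqF m10).
have -> : f 0 = (1 - m) * A t - t * (I1 - I2) by rewrite H; ring.
by ring.
Qed.

End derivative.

End abel_derivative.

Section smooth_abel.
Context {R : realType}.
Notation mu := (@lebesgue_measure R).
Variables (e m : R).
Hypotheses (e0 : 0 < e) (m1 : m < 1).
Implicit Types (f g : R -> R) (t : R).

Lemma smooth_abel f : smooth (- e) f -> smooth 0 (abel m f).
Proof.
move=> sf k; elim: k f sf => [|k IH] f sf; first exact: smooth_upto0.
have sg : smooth_upto k 0 (fun t => f 0 * t `^ (- m) + abel m (derive1 f) t).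
  apply: smooth_uptoD; last exact: IH (smooth_derive1 sf).
  apply: smooth_uptoM; [exact: smooth_cst|exact: smooth_powR].
by apply: (smooth_uptoS _ sg) => x x0; exact: (is_derive_abel e0 sf m1 x0).
Qed.

Lemma abelD f g t : smooth (- e) f -> smooth (- e) g -> 0 < t ->
  abel m (fun s => f s + g s) t = abel m f t + abel m g t.
Proof.
move=> sf sg t0; rewrite /abel !abel_kernelE.
have i1 := integrable_itv_oo_cc (integrable_abel_smooth e0 sf m1 t0).
have i2 := integrable_itv_oo_cc (integrable_abel_smooth e0 sg m1 t0).
by rewrite -RintegralD//; apply: eq_Rintegral => s _; rewrite mulrDl.
Qed.

Lemma eq_abel f g t : (forall s, 0 < s -> s < t -> f s = g s) -> 0 < t ->
  mu.-integrable `]0, t[ (EFin \o (fun s => f s * (t - s) `^ (- m))) ->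
  abel m f t = abel m g t.
Proof.
move=> fg t0 fi.
have gi : mu.-integrable `]0, t[ (EFin \o (fun s => g s * (t - s) `^ (- m))).
  apply: eq_integrable_real fi => //.
  by move=> x; rewrite /= in_itv/= => /andP[x0 xt]; rewrite fg.
rewrite /abel !abel_kernelE (Rintegral_itv_oo_cc fi) (Rintegral_itv_oo_cc gi).
by apply: eq_Rintegral => s; rewrite inE/= in_itv/= => /andP[s0 st]; rewrite fg.
Qed.

Lemma eq_abel_smooth f g t : (forall s, 0 < s -> f s = g s) -> smooth (- e) f ->
  0 < t -> abel m f t = abel m g t.
Proof.
move=> fg sf t0; apply: eq_abel => //; first by move=> s s0 _; exact: fg.
exact: integrable_abel_smooth e0 sf m1 t0.
Qed.

(** The boundary term is what prevents a Riemann-Liouville derivative from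
    commuting with a derivative. *)
Lemma derive1nS_abel k f t : smooth (- e) f -> 0 < t ->
  derive1n k.+1 (abel m f) t =
  f 0 * derive1n k (fun t => t `^ (- m)) t + derive1n k (abel m (derive1 f)) t.
Proof.
move=> sf t0; rewrite derive1Sn.
have s1 := @smooth_powR R (- m); have s2 := smooth_abel (smooth_derive1 sf).
rewrite -(derive1nMl _ (f 0) s1 t0).
rewrite -(derive1nD _ (@smoothMl _ _ (f 0) _ s1) s2 t0).
apply: (@eq_derive1n _ k 0 _ _ _ _ t0) => y y0.
by have /is_derive_derive1[] := is_derive_abel e0 sf m1 y0.
Qed.

End smooth_abel.

(** * Exchanging time derivatives with the integral over the gamma density *)

Section atom.
Context {R : realType}.
Notation mu := (@lebesgue_measure R).
Implicit Types (w a : R -> R) (al p e y s t : R) (i k : nat).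

(** The time derivatives of a gamma density at [y] are sums of such terms. *)
Definition atom al p a i y s := a s * mterm (cst 1) al i (p * s) y.

Lemma smooth_mterm w al i y e : 0 < y -> smooth e (fun x => mterm w al i x y).
Proof.
move=> y0 k; elim: k i => [|k IH] i; first exact: smooth_upto0.
by apply: (smooth_uptoS _ (IH i.+1)) => x _; exact: is_derive_mterm.
Qed.

Variables (al p : R).
Hypothesis p0 : 0 < p.

Lemma smooth_scale_arg e g : smooth (p * e) g -> smooth e (fun s => g (p * s)).
Proof.
move=> sg; have -> : (fun s => g (p * s)) = (fun s => g (p * s + 0)).
  by apply/funext => x; rewrite addr0.
by apply: smooth_affine sg => x ex; rewrite addr0 ltr_pM2l.
Qed.

Lemma is_derive_scale_arg (g : R -> R) s d : is_derive (p * s) 1 g d ->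
  is_derive s 1 (fun s => g (p * s)) (p * d).
Proof.
move=> dg; have -> : (fun s => g (p * s)) = (fun s => g (p * s + 0)).
  by apply/funext => x; rewrite addr0.
by apply: is_derive_affine; rewrite addr0.
Qed.

Lemma smooth_atom e a i y : smooth e a -> 0 < y -> smooth e (atom al p a i y).
Proof.
move=> sa y0; apply: smoothM sa _.
exact: smooth_scale_arg (@smooth_mterm _ _ _ _ _ y0).
Qed.

Lemma derive1_atom e a i y s : smooth e a -> 0 < y -> e < s ->
  derive1 (atom al p a i y) s =
  atom al p (derive1 a) i y s + atom al p (fun s => p * a s) i.+1 y s.
Proof.
move=> sa y0 es.
have d1 := smooth_is_derive sa es.
have d2 := is_derive_scale_arg (is_derive_mterm (cst 1) al i (p * s) y0).
have /is_derive_derive1[_] := is_deriveM d1 d2.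
by rewrite /GRing.scale/= /atom => ->; ring.
Qed.

Variables (w : R -> R) (b C : R).
Hypotheses (al0 : 0 < al) (mw : measurable_fun (`]0, +oo[%classic : set R) w).
Hypotheses (C0 : 0 <= C) (wC : forall y, 0 < y -> `|w y| <= C * y `^ b).

Lemma w_atom a i y s :
  w y * ln y * atom al p a i y s = a s * mterm w al i.+1 (p * s) y.
Proof. by rewrite /atom /mterm exprS /=; ring. Qed.

Definition atom_moment a i s := a s * moment w al i (p * s).

Lemma smooth_atom_moment e a i : - b <= p * e -> smooth e a ->
  smooth e (atom_moment a i).
Proof.
move=> be sa; apply: smoothM sa (@smooth_scale_arg e (moment w al i) _).
have := @smooth_moment _ w al b C al0 mw C0 wC i.
exact: smoothW be.
Qed.

Lemma derive1_atom_moment e a i s : - b <= p * e -> smooth e a -> e < s ->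
  derive1 (atom_moment a i) s =
  atom_moment (derive1 a) i s + atom_moment (fun s => p * a s) i.+1 s.
Proof.
move=> be sa es; have bs : - b < p * s by rewrite (le_lt_trans be)// ltr_pM2l.
have d1 := smooth_is_derive sa es.
have d2 := is_derive_scale_arg (is_derive_moment al0 mw C0 wC i bs).
have /is_derive_derive1[_] := is_deriveM d1 d2.
by rewrite /GRing.scale/= /atom_moment => ->; ring.
Qed.

Lemma integrable_w_atom a i s : - b < p * s ->
  mu.-integrable `]0, +oo[ (EFin \o (fun y => w y * ln y * atom al p a i y s)).
Proof.
move=> bs.
apply: eq_integrable_real
  (integrable_realZ _ (a s) (integrable_mterm al0 mw C0 wC i.+1 bs)) => //.
by move=> y _; rewrite w_atom.
Qed.

Lemma integral_w_atom a i s : - b < p * s ->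
  \int[mu]_(y in `]0, +oo[) (w y * ln y * atom al p a i y s) =
  atom_moment a i.+1 s.
Proof.
move=> bs; rewrite /atom_moment -RintegralZl//.
  by apply: eq_Rintegral => y _; rewrite w_atom.
exact: (integrable_mterm al0 mw C0 wC).
Qed.

Lemma smooth_cstM e a : smooth e a -> smooth e (fun s => p * a s).
Proof. by move=> sa; exact: (@smoothMl _ _ p _ sa). Qed.

(** Induction on [k]: by [derive1_atom] and [derive1_atom_moment] the atoms and
    their integrals are differentiated by the same rule, which replaces [a] by
    its derivative, or by [p * a] with one more logarithm. *)
Lemma derive1n_integral_atom k a i t : 0 <= b -> smooth 0 a -> 0 < t ->
  mu.-integrable `]0, +oo[
    (EFin \o (fun y => w y * ln y * derive1n k (atom al p a i y) t)) /\
  \int[mu]_(y in `]0, +oo[) (w y * ln y * derive1n k (atom al p a i y) t) =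
  derive1n k (atom_moment a i.+1) t.
Proof.
move=> b0; elim: k a i => [|k IH] a i sa t0.
  have bt : - b < p * t by rewrite (@le_lt_trans _ _ 0) ?oppr_le0 ?mulr_gt0.
  by split; [exact: integrable_w_atom|exact: integral_w_atom].
have b00 : - b <= p * 0 by rewrite mulr0 oppr_le0.
have [i1 e1] := IH _ i (smooth_derive1 sa) t0.
have [i2 e2] := IH _ i.+1 (smooth_cstM sa) t0.
have E y : 0 < y -> w y * ln y * derive1n k.+1 (atom al p a i y) t =
    w y * ln y * derive1n k (atom al p (derive1 a) i y) t +
    w y * ln y * derive1n k (atom al p (fun s => p * a s) i.+1 y) t.
  move=> y0; rewrite -mulrDr; congr (_ * _); rewrite derive1Sn.
  have s1 : smooth 0 (atom al p (derive1 a) i y).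
    exact: smooth_atom (smooth_derive1 sa) y0.
  have s2 : smooth 0 (atom al p (fun s => p * a s) i.+1 y).
    exact: smooth_atom (smooth_cstM sa) y0.
  rewrite -(derive1nD _ s1 s2 t0).
  by apply: (@eq_derive1n _ _ 0 _ _ _ _ t0) => s s0; exact: derive1_atom sa y0 s0.
split.
  apply: eq_integrable_real (integrable_realD _ i1 i2) => //.
  by move=> y; rewrite /= in_itv/= andbT => y0; rewrite E.
under eq_Rintegral.
  move=> y; rewrite inE/= in_itv/= andbT => y0; rewrite E//; over.
rewrite RintegralD// e1 e2 derive1Sn.
have s1 : smooth 0 (atom_moment (derive1 a) i.+1).
  exact: smooth_atom_moment b00 (smooth_derive1 sa).
have s2 : smooth 0 (atom_moment (fun s => p * a s) i.+2).
  exact: smooth_atom_moment b00 (smooth_cstM sa).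
rewrite -(derive1nD _ s1 s2 t0).
apply: (@eq_derive1n _ _ 0 _ _ _ _ t0) => s s0.
by rewrite (derive1_atom_moment _ b00 sa s0).
Qed.

Section abel_atom.
Variables (m : R).
Hypotheses (b0 : 0 < b) (m1 : m < 1).
Let e := b / p.
Let e0 : 0 < e. Proof. by rewrite divr_gt0. Qed.
Let bpe : - b <= p * - e.
Proof. by rewrite /e mulrN mulrCA divff ?mulr1// gt_eqF. Qed.

Section fubini.
Variables (a : R -> R) (i : nat) (t : R).
Hypotheses (sa : smooth (- e) a) (t0 : 0 < t).

Let S : set R := [set` `]0, t[].
Let Y : set R := [set` `]0, +oo[].
Let A : R -> R := (fun s => a s * (t - s) `^ (- m)) \_ S.
Let W : R -> R := w \_ Y.
(* [y `^ (p * s - 1)] is written with [expR] to be jointly measurable. *)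
Let F (z : measurableTypeR R * measurableTypeR R) : R :=
  A z.2 * (W z.1 * ln z.1 ^+ i.+1 * expR ((p * z.2 - 1) * ln z.1) *
    expR (- (al * z.1))).

Let mS : measurable S. Proof. exact: measurable_itv. Qed.
Let mY : measurable Y. Proof. exact: measurable_itv. Qed.

Let FE s y : S s -> Y y ->
  F (y, s) = a s * (t - s) `^ (- m) * mterm w al i.+1 (p * s) y.
Proof.
move=> Ss Yy; rewrite /F /A /W !patchE !mem_set//= /mterm.
move: Yy; rewrite /Y/= in_itv/= andbT => y0.
by have -> : y `^ (p * s - 1) = expR ((p * s - 1) * ln y) by rewrite /powR gt_eqF.
Qed.

Let F0S s y : ~ S s -> F (y, s) = 0.
Proof. by move=> Ss; rewrite /F /A patchE memNset// mul0r. Qed.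

Let F0Y s y : ~ Y y -> F (y, s) = 0.
Proof.
move=> Yy; rewrite /F /=; have -> : W y = 0 by rewrite /W patchE memNset.
by rewrite !mul0r mulr0.
Qed.

Let mF : measurable_fun setT F.
Proof.
have mA : measurable_fun setT A.
  apply/(measurable_restrictT _ _).1 => //.
  apply: measurable_funM.
    apply: smooth_measurable e0 sa _ _ => // x.
    by rewrite /S/= !in_itv/= => /andP[->].
  exact: integrable_real_measurable (integrable_abel_kernel m1 t0).
have mW : measurable_fun setT W by exact/(measurable_restrictT _ _).1.
have m1' : measurable_fun setT
    (fst : measurableTypeR R * measurableTypeR R -> measurableTypeR R).
  exact: measurable_fst.
have m2' : measurable_fun setT
    (snd : measurableTypeR R * measurableTypeR R -> measurableTypeR R).
  exact: measurable_snd.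
have mln : measurable_fun setT (fun z : measurableTypeR R * measurableTypeR R => ln z.1).
  by apply: measurableT_comp m1'; exact: measurable_ln.
apply: measurable_funM; first exact: measurableT_comp mA m2'.
apply: measurable_funM.
  apply: measurable_funM.
    apply: measurable_funM; first exact: measurableT_comp mW m1'.
    exact: measurable_funX.
  apply: measurableT_comp => //; apply: measurable_funM => //.
  by apply: measurable_funB => //; exact: measurable_funM.
apply: measurableT_comp => //; apply: measurableT_comp => //.
exact: measurable_funM.
Qed.

Let integrable_F : (mu \x mu)%E.-integrable setT (EFin \o F).
Proof.
have [M M0 hM] := smooth_bounded e0 sa (ltW t0).
have b0' : - b < 0 by rewrite oppr_lt0.
have [D [iD D0 hD]] := mterm_dominated al0 C0 wC i.+1 (p * t) b0'.
have iK' : mu.-integrable S (EFin \o (fun s => M * (t - s) `^ (- m))).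
  by apply: integrable_realZ => //; exact: integrable_abel_kernel.
have iK : mu.-integrable setT (EFin \o ((fun s => M * (t - s) `^ (- m)) \_ S)).
  exact: (integrable_restrictT _ _ _).1.
have iD' : mu.-integrable setT (EFin \o (D \_ Y)).
  exact: (integrable_restrictT _ _ _).1.
apply: le_integrable_real (integrable_prodM iD' iK) => //.
move=> [y s] _ /=.
have [Ss|Ss] := pselect (S s); last first.
  by rewrite F0S// normr0 [X in _ * X]patchE memNset// mulr0.
have [Yy|Yy] := pselect (Y y); last first.
  by rewrite F0Y// normr0 [X in X * _]patchE memNset// mul0r.
rewrite FE// !patchE !mem_set// (normrM (a s * _)) (normrM (a s)).
rewrite (ger0_norm (powR_ge0 _ _)) mulrC.
move: Ss Yy; rewrite /S /Y/= !in_itv/= andbT => /andP[s0 st] y0.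
apply: ler_pM => //; first by rewrite mulr_ge0// powR_ge0.
  by apply: hD => //; [rewrite mulr_ge0 ?ltW|rewrite ler_pM2l// ltW].
by rewrite ler_wpM2r ?powR_ge0// hM ?ltW.
Qed.

Let inner_s y : (\int[mu]_s (F (y, s))%:E =
  (((fun y => w y * ln y * abel m (atom al p a i y) t) \_ Y) y)%:E)%E.
Proof.
rewrite patchE; case: ifPn => [/set_mem Yy|/negP]; last first.
  rewrite inE => Yy; rewrite integral0_eq// => s _; by rewrite F0Y.
have y0 : 0 < y by move: Yy; rewrite /Y/= in_itv/= andbT.
have iy := integrable_abel_smooth e0 (smooth_atom (e := - e) (i := i) sa y0) m1 t0.
rewrite /abel abel_kernelE (Rintegral_itv_oo_cc iy) -RintegralZl//.
rewrite /Rintegral fineK; last first.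
  by apply: integrable_fin_num => //; exact: integrable_realZ.
rewrite integral_mkcond; apply: eq_integral => s _.
rewrite patchE; case: ifPn => [/set_mem Ss|/negP]; last first.
  by rewrite inE => Ss; rewrite F0S.
by rewrite FE// mulrA w_atom mulrAC.
Qed.

Let inner_y s : (\int[mu]_y (F (y, s))%:E =
  (((fun s => atom_moment a i.+1 s * (t - s) `^ (- m)) \_ S) s)%:E)%E.
Proof.
rewrite patchE; case: ifPn => [/set_mem Ss|/negP]; last first.
  by rewrite inE => Ss; rewrite integral0_eq// => y _; rewrite F0S.
have s0 : 0 < s by move: Ss; rewrite /S/= in_itv/= => /andP[].
have bs : - b < p * s.
  by rewrite (lt_trans (y := 0)) ?oppr_lt0// mulr_gt0.
have iy := integrable_mterm al0 mw C0 wC i.+1 bs.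
rewrite /atom_moment mulrAC /moment -RintegralZl// /Rintegral fineK; last first.
  by apply: integrable_fin_num => //; exact: integrable_realZ.
rewrite integral_mkcond; apply: eq_integral => y _.
rewrite patchE; case: ifPn => [/set_mem Yy|/negP]; last first.
  by rewrite inE => Yy; rewrite F0Y.
by rewrite FE.
Qed.

(** Fubini's theorem; the integrand is dominated by a product of [(t - s) `^ (- m)]
    and of an integrable function of [y], down to [s = 0] because the weight is
    [O(y^b)] with [0 < b]. *)
Lemma integral_abel_atom :
  mu.-integrable `]0, +oo[
    (EFin \o (fun y => w y * ln y * abel m (atom al p a i y) t)) /\
  \int[mu]_(y in `]0, +oo[) (w y * ln y * abel m (atom al p a i y) t) =
  abel m (atom_moment a i.+1) t.
Proof.
split.
  apply: (integrable_restrictT _ _ _).2 => //.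
  have := integrable_fubini_F integrable_F; apply: eq_integrable => // y _.
  by rewrite /fubini_F/= inner_s.
have sm : smooth (- e) (atom_moment a i.+1) by exact: smooth_atom_moment bpe sa.
have im := integrable_abel_smooth e0 sm m1 t0.
rewrite /abel abel_kernelE (Rintegral_itv_oo_cc im).
rewrite /Rintegral !(integral_mkcond _ (EFin \o _)) !restrict_EFin; congr fine.
have := Fubini integrable_F; rewrite /=.
under eq_integral do rewrite inner_s.
by under [in X in _ = X -> _]eq_integral do rewrite inner_y.
Qed.

End fubini.

(** As for [derive1n_integral_atom]; each derivative crossing the Abel kernel
    leaves a boundary term proportional to the atom at time [0], which is
    integrated separately. *)
Lemma derive1n_integral_abel_atom k a i t : smooth (- (b / p)) a -> 0 < t ->
  mu.-integrable `]0, +oo[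
    (EFin \o (fun y => w y * ln y * derive1n k (abel m (atom al p a i y)) t)) /\
  \int[mu]_(y in `]0, +oo[)
    (w y * ln y * derive1n k (abel m (atom al p a i y)) t) =
  derive1n k (abel m (atom_moment a i.+1)) t.
Proof.
move=> sa t0; elim: k a i sa => [|k IH] a i sa; first exact: integral_abel_atom.
have [i1 e1] := IH _ i (smooth_derive1 sa).
have [i2 e2] := IH _ i.+1 (smooth_cstM sa).
have b00 : - b < p * 0 by rewrite mulr0 oppr_lt0.
have i0 := integrable_w_atom a i b00; have e00 := integral_w_atom a i b00.
pose D := derive1n k (fun t => t `^ (- m)) t.
have E y : 0 < y -> w y * ln y * derive1n k.+1 (abel m (atom al p a i y)) t =
    D * (w y * ln y * atom al p a i y 0) +
    (w y * ln y * derive1n k (abel m (atom al p (derive1 a) i y)) t +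
    w y * ln y * derive1n k (abel m (atom al p (fun s => p * a s) i.+1 y)) t).
  move=> y0.
  have s1 : smooth (- e) (atom al p (derive1 a) i y).
    exact: smooth_atom (smooth_derive1 sa) y0.
  have s2 : smooth (- e) (atom al p (fun s => p * a s) i.+1 y).
    exact: smooth_atom (smooth_cstM sa) y0.
  have s12 := smoothD s1 s2.
  rewrite (derive1nS_abel e0 m1 _ (smooth_atom sa y0) t0) -/D.
  rewrite -[in RHS]mulrDr [D * _]mulrCA -mulrDr; congr (_ * (_ + _)).
    by rewrite mulrC.
  rewrite -(derive1nD _ (smooth_abel e0 m1 s1) (smooth_abel e0 m1 s2) t0).
  apply: (@eq_derive1n _ _ 0 _ _ _ _ t0) => s s0.
  rewrite -(abelD e0 m1 s1 s2 s0); symmetry.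
  apply: (eq_abel_smooth e0 m1 _ s12 s0) => r r0.
  by rewrite (derive1_atom _ sa y0)// (lt_trans _ r0)// oppr_lt0.
have i12 : mu.-integrable `]0, +oo[ (EFin \o (fun y =>
    w y * ln y * derive1n k (abel m (atom al p (derive1 a) i y)) t +
    w y * ln y * derive1n k (abel m (atom al p (fun s => p * a s) i.+1 y)) t)).
  exact: integrable_realD i1 i2.
split.
  apply: eq_integrable_real (integrable_realD _ (integrable_realZ _ D i0) i12) => //.
  by move=> y; rewrite /= in_itv/= andbT => y0; rewrite E.
under eq_Rintegral.
  move=> y; rewrite inE/= in_itv/= andbT => y0; rewrite E//; over.
have iD : mu.-integrable `]0, +oo[
    (EFin \o (fun y => D * (w y * ln y * atom al p a i y 0))).
  exact: integrable_realZ.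
rewrite RintegralD; [|exact: measurable_itv|exact: iD|exact: i12].
rewrite RintegralD; [|exact: measurable_itv|exact: i1|exact: i2].
rewrite RintegralZl; [|exact: measurable_itv|exact: i0].
rewrite e1 e2 e00.
have sm : smooth (- e) (atom_moment a i.+1) by exact: smooth_atom_moment bpe sa.
have s1 : smooth (- e) (atom_moment (derive1 a) i.+1).
  exact: smooth_atom_moment bpe (smooth_derive1 sa).
have s2 : smooth (- e) (atom_moment (fun s => p * a s) i.+2).
  exact: smooth_atom_moment bpe (smooth_cstM sa).
have s12 := smoothD s1 s2.
rewrite (derive1nS_abel e0 m1 _ sm t0) -/D mulrC; congr (_ + _).
rewrite -(derive1nD _ (smooth_abel e0 m1 s1) (smooth_abel e0 m1 s2) t0).
apply: (@eq_derive1n _ _ 0 _ _ _ _ t0) => s s0.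
rewrite -(abelD e0 m1 s1 s2 s0).
apply: (eq_abel_smooth e0 m1 _ s12 s0) => r r0.
by rewrite (derive1_atom_moment _ bpe sa)// (lt_trans _ r0)// oppr_lt0.
Qed.

End abel_atom.

End atom.

(** * Subordination *)

Section limit_of_events.
Context d (T : measurableType d) {R : realType} (P : probability T R).

(** Dominated convergence for indicator functions. *)
Lemma cvg_probability_sets (A : nat -> set T) (B : set T) :
  (forall k, measurable (A k)) ->
  (forall w, \forall k \near \oo, A k w <-> B w) ->
  measurable B /\ (P (A k) @[k --> \oo] --> P B).
Proof.
move=> mA AB; have BE : B = \bigcup_k \bigcap_(j in [set j | (k <= j)%N]) A j.
  apply/seteqP; split => [w Bw|w [k _ kAw]]; have [k0 _ hk] := AB w.
    by exists k0 => // j /= kj; apply/hk.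
  apply/(hk (maxn k k0)); first exact: leq_maxr.
  by apply: kAw; exact: leq_maxl.
have mB : measurable B.
  by rewrite BE; apply: bigcup_measurable => k _; exact: bigcap_measurableType.
split=> //.
have PE (D : set T) : measurable D -> P D = (\int[P]_w (\1_D w)%:E)%E.
  by move=> mD; rewrite integral_indic// setIT.
rewrite PE//; under eq_fun do rewrite PE//.
apply: (@dominated_cvg _ _ _ P setT measurableT (fun k w => (\1_(A k) w)%:E)
  (fun w => (\1_B w)%:E) (cst 1%E)) => //.
- by move=> k; exact/measurable_EFinP.
- move=> w _; apply: cvg_near_cst; have := AB w; apply: filterS => k ABw.
  rewrite !indicE; suff -> : (w \in A k) = (w \in B) by [].
  by apply/idP/idP; rewrite !inE => ?; apply/ABw.
- exact: finite_measure_integrable_cst.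
- by move=> k w _; rewrite /= indicE lee_fin; case: (_ \in _); rewrite ?normr1 ?normr0.
Qed.

End limit_of_events.

Section rounding.
Context {R : realType}.
Implicit Types (y : R) (k j : nat).

(** Rounding up strictly, so that the limit is from the right. *)
Definition round_up k y : R := (Num.truncn (y * k.+1%:R)).+1%:R / k.+1%:R.

Definition round_cell k j : set R := [set` `[j%:R / k.+1%:R, j.+1%:R / k.+1%:R[ ].

Lemma round_cellP k j y : 0 <= y ->
  round_cell k j y <-> Num.truncn (y * k.+1%:R) = j.
Proof.
move=> y0; rewrite /round_cell/= in_itv/= ler_pdivrMr ?ltr0n// ltr_pdivlMr ?ltr0n//.
have := @truncn_eq _ (y * k.+1%:R) j; rewrite mulr_ge0 ?ler0n// => /(_ isT) <-.
by split => [/eqP|->].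
Qed.

Lemma round_cell_ge0 k j y : round_cell k j y -> 0 <= y.
Proof.
by rewrite /round_cell/= in_itv/= => /andP[+ _]; apply: le_trans; rewrite divr_ge0.
Qed.

Lemma round_up_cell k j y : round_cell k j y -> round_up k y = j.+1%:R / k.+1%:R.
Proof.
move=> cy; have y0 := round_cell_ge0 cy.
by rewrite /round_up ((round_cellP k j y0).1 cy).
Qed.

Lemma bigcup_round_cell k : \bigcup_j round_cell k j = [set` `[0, +oo[].
Proof.
apply/seteqP; split => [y [j _ /round_cell_ge0]|y] /=; rewrite in_itv/= andbT//.
by move=> y0; exists (Num.truncn (y * k.+1%:R)) => //; exact/round_cellP.
Qed.

Lemma trivIset_round_cell k : trivIset setT (round_cell k).
Proof.
apply/trivIsetP => i j _ _ ij; rewrite -subset0 => y [ci cj].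
have y0 := round_cell_ge0 ci.
by move: ij; rewrite -((round_cellP k i y0).1 ci) ((round_cellP k j y0).1 cj) eqxx.
Qed.

Lemma round_up_gt k y : y < round_up k y.
Proof. by rewrite /round_up ltr_pdivlMr ?ltr0n// truncnS_gt. Qed.

Lemma round_up_le k y : 0 <= y -> round_up k y <= y + k.+1%:R^-1.
Proof.
move=> y0; rewrite /round_up ler_pdivrMr ?ltr0n// mulrDl mulVf ?pnatr_eq0//.
by rewrite -natr1 lerD2r truncn_le mulr_ge0.
Qed.

Lemma near_round_up y (Q : R -> Prop) : 0 <= y ->
  (\forall s \near y^'+, Q s) -> \forall k \near \oo, Q (round_up k y).
Proof.
move=> y0 [e /= e0 eQ].
have := @cvg_harmonic R => /cvgr0_norm_lt/(_ _ e0); apply: filterS => k.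
rewrite /harmonic/= ger0_norm ?invr_ge0// => ke.
apply: eQ; last exact: round_up_gt.
rewrite /ball_/= distrC ger0_norm ?subr_ge0 ?ltW ?round_up_gt//.
by rewrite ltrBlDl (le_lt_trans (round_up_le k y0))// ltrD2l.
Qed.

End rounding.

Section subordination.
Context {R : realType} {d : measure_display} {T : measurableType d}.
Variable P : probability T R.
Notation mu := (@lebesgue_measure R).
Variables (alpha p : R) (N : R -> {RV P >-> nat}) (G : R -> {RV P >-> R}).
Variable phi : nat -> R -> R.
Hypothesis N_law : forall n t, 0 <= t -> P (N t @^-1` [set n]) = (phi n t)%:E.
Hypothesis N_right : forall w t, 0 <= t -> \forall s \near t^'+, N s w = N t w.
Hypotheses (hG : is_gamma_process alpha p G) (hNG : independent_processes N G).
Implicit Types (n k j : nat) (t y : R).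

Lemma measurable_N t n : measurable (N t @^-1` [set n]).
Proof. by rewrite -[X in measurable X]setTI; exact: measurable_funP. Qed.

Lemma measurable_G t (B : set R) : measurable B -> measurable (G t @^-1` B).
Proof. by move=> mB; rewrite -[X in measurable X]setTI; exact: measurable_funP. Qed.

Lemma law_ge0 n t : 0 <= t -> 0 <= phi n t.
Proof. by move=> t0; rewrite -lee_fin -N_law. Qed.

Lemma law_le1 n t : 0 <= t -> phi n t <= 1.
Proof.
by move=> t0; rewrite -lee_fin -N_law//; apply: probability_le1; exact: measurable_N.
Qed.

Lemma law_compl n t : (0 < n)%N -> 0 <= t -> phi n t <= 1 - phi 0 t.
Proof.
move=> n0 t0.
have : (P (N t @^-1` [set n]) + P (N t @^-1` [set 0%N]) <= 1)%E.
  rewrite -measureU; [|exact: measurable_N|exact: measurable_N|].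
    by apply: probability_le1; apply: measurableU; exact: measurable_N.
  by rewrite -subset0 => w [/= ->] n00; rewrite n00 in n0.
by rewrite (N_law n t0) (N_law 0 t0) -EFinD lee_fin lerBrDr.
Qed.

Lemma law_round_cvg n y : 0 <= y ->
  phi n (round_up k y) @[k --> \oo] --> phi n y.
Proof.
move=> y0; have ry k : 0 <= round_up k y by rewrite ltW// (le_lt_trans y0)// round_up_gt.
have [|w|_ H] := @cvg_probability_sets _ _ _ P
  (fun k => N (round_up k y) @^-1` [set n]) (N y @^-1` [set n]).
- by move=> k; exact: measurable_N.
- have /= := N_right w y0 => /(near_round_up y0).
  by apply: filterS => k; rewrite /preimage/= => ->.
move: H; rewrite N_law//; under eq_fun do rewrite N_law//.
by move=> /fine_cvgP[].
Qed.

Lemma measurable_law_round n k :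
  measurable_fun [set` `[(0 : R), +oo[] (fun y => phi n (round_up k y)).
Proof.
rewrite -(bigcup_round_cell k); apply/measurable_fun_bigcup.
  by move=> j; exact: measurable_itv.
move=> j; apply: (eq_measurable_fun (cst (phi n (j.+1%:R / k.+1%:R)))).
  by move=> y /set_mem cy /=; rewrite (round_up_cell cy).
exact: measurable_cst.
Qed.

(** A pointwise limit of step functions, by right continuity. *)
Lemma measurable_law n : measurable_fun [set` `[(0 : R), +oo[] (phi n).
Proof.
apply: (measurable_fun_cvg (h := fun k y => phi n (round_up k y))).
  by move=> k; exact: measurable_law_round.
by move=> y; rewrite /= in_itv/= andbT => y0; exact: law_round_cvg.
Qed.

Lemma gamma_process_ge0 t w : 0 <= t -> 0 <= G t w.
Proof.
case: hG => G0 Gmono _ _ _ t0; rewrite -[leLHS](G0 w); exact: Gmono.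
Qed.

Lemma gamma_process_law t (B : set R) : 0 < t -> measurable B ->
  P (G t @^-1` B) = (\int[mu]_(y in B) (gamma_pdf alpha (p * t) y)%:E)%E.
Proof.
case: hG => G0 _ _ law _ t0 mB; have := law 0 t B (lexx 0) t0 mB.
rewrite subr0 => <-; congr (P _); apply/seteqP.
by split => w /=; rewrite G0 subr0.
Qed.

Section fixed_time.
Variables (n : nat) (t : R).
Hypotheses (t0 : 0 < t) (pt0 : 0 < p * t).
Let g := gamma_pdf alpha (p * t).
Let Y : set R := [set` `[0, +oo[].
Let mY : measurable Y. Proof. exact: measurable_itv. Qed.

Lemma gamma_pdf_ge0 y : 0 <= g y.
Proof.
rewrite /g /gamma_pdf; case: ifP => // /andP[y0 a0].
by rewrite !mulr_ge0 ?powR_ge0 ?expR_ge0 ?invr_ge0// ltW// Gamma_gt0.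
Qed.

Lemma measurable_gamma_pdf (D : set R) : measurable D -> measurable_fun D g.
Proof.
move=> mD; apply: measurable_funTS.
pose h y := alpha `^ (p * t) / Gamma (p * t) * y `^ (p * t - 1) * expR (- (alpha * y)).
have -> : g = h \_ [set` `]0, +oo[].
  apply/funext => y; rewrite patchE /g /gamma_pdf pt0 andbT.
  by case: ifPn => [y0|y0]; [rewrite mem_set//= in_itv/= y0|
    rewrite memNset//= in_itv/= andbT; exact/negP].
apply/(measurable_restrictT _ _).1 => //.
apply: measurable_funM.
  by apply: measurable_funM => //; exact: measurable_funTS (measurable_powR _).
by apply: measurableT_comp => //; apply: measurableT_comp.
Qed.

Lemma integral_gamma_pdf : (\int[mu]_(y in Y) (g y)%:E = 1)%E.
Proof.
have := gamma_process_law t0 (measurable_itv (R := R) `[0, +oo[) => <-.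
rewrite -(probability_setT P); congr (P _); apply/seteqP; split => // w _ /=.
by rewrite in_itv/= andbT gamma_process_ge0// ltW.
Qed.

Lemma integrable_gamma_pdf : mu.-integrable Y (EFin \o g).
Proof.
apply/integrableP; split.
  by apply/measurable_EFinP; exact: measurable_gamma_pdf.
under eq_integral do rewrite /= ger0_norm ?gamma_pdf_ge0//.
by rewrite integral_gamma_pdf ltry.
Qed.

Let A k := [set w | N (round_up k (G t w)) w = n].
Let Aj k j := (N (j.+1%:R / k.+1%:R) @^-1` [set n]) `&` (G t @^-1` round_cell k j).

Let AE k : A k = \bigcup_j Aj k j.
Proof.
apply/seteqP; split => [w Aw|w [j _ [/= Nw cw]]]; last by rewrite /A/= (round_up_cell cw).
exists (Num.truncn (G t w * k.+1%:R)) => //; split => //=.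
by apply/round_cellP => //; exact/gamma_process_ge0/ltW.
Qed.

Let mAj k j : measurable (Aj k j).
Proof.
apply: measurableI; first exact: measurable_N.
by apply: measurable_G; exact: measurable_itv.
Qed.

Let mA k : measurable (A k).
Proof. by rewrite AE; exact: bigcup_measurable. Qed.

(* Independence is used here, at a single deterministic time of [N]. *)
Let PAj k j : P (Aj k j) =
  (\int[mu]_(y in round_cell k j) (phi n (round_up k y) * g y)%:E)%E.
Proof.
have u0 : (0 : R) <= j.+1%:R / k.+1%:R by rewrite divr_ge0.
have := hNG 1 1 (u := fun=> j.+1%:R / k.+1%:R) (v := fun=> t)
  (fun=> [set n]) (B := fun=> round_cell k j) (fun=> u0) (fun=> ltW t0)
  (fun=> measurable_itv _).
have bc (X : set T) : \bigcap_(i < 1) X = X.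
  by apply/seteqP; split => [w /(_ 0%N)|w Xw i _]; [exact|].
rewrite !bc => ->; rewrite N_law// gamma_process_law//.
rewrite -ge0_integralZl//.
- apply: eq_integral => y /set_mem cy; rewrite (round_up_cell cy) EFinM//.
- exact: measurable_itv.
- by apply/measurable_EFinP; apply: measurable_gamma_pdf; exact: measurable_itv.
- by move=> y _; rewrite lee_fin gamma_pdf_ge0.
- by rewrite lee_fin law_ge0.
- exact: measurable_itv.
Qed.

Let PA k : P (A k) = (\int[mu]_(y in Y) (phi n (round_up k y) * g y)%:E)%E.
Proof.
rewrite AE measure_semi_bigcup//; last 2 first.
  apply/trivIsetP => i j _ _ ij; rewrite -subset0 => w [[_ ci] [_ cj]].
  have /trivIsetP/(_ i j I I ij) := @trivIset_round_cell R k.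
  by rewrite -subset0 => /(_ (G t w)); apply.
  by rewrite -AE.
rewrite (eq_eseriesr (fun j _ => PAj k j)).
rewrite /Y -(bigcup_round_cell k) ge0_integral_bigcup//.
- by move=> j; exact: measurable_itv.
- rewrite bigcup_round_cell; apply/measurable_EFinP/measurable_funM.
    exact: measurable_law_round.
  exact: measurable_gamma_pdf.
- rewrite bigcup_round_cell => y; rewrite /= in_itv/= andbT => y0.
  rewrite lee_fin mulr_ge0 ?gamma_pdf_ge0// law_ge0//.
  by rewrite ltW// (le_lt_trans y0)// round_up_gt.
- exact: trivIset_round_cell.
Qed.

(** Conditioning on [G t] is only licit for countably many times of [N], hence
    the discretisation: [N] is read at [G t] rounded up to a grid, where
    independence gives the formula cell by cell, and the right continuity of the
    paths of [N] lets the mesh tend to [0]. *)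
Lemma fnbp_probability :
  measurable [set w | fnbp N G t w = n] /\
  P [set w | fnbp N G t w = n] = (\int[mu]_(y in Y) (phi n y * g y)%:E)%E.
Proof.
have [|w|mB cvB] := @cvg_probability_sets _ _ _ P A [set w | fnbp N G t w = n].
- exact: mA.
- have Gw0 := gamma_process_ge0 w (ltW t0).
  have /= := N_right w Gw0 => /(near_round_up Gw0).
  by apply: filterS => k; rewrite /A/= /fnbp => ->.
split => //; apply: (cvg_unique _ cvB) => //=.
under eq_fun do rewrite PA.
apply: (@dominated_cvg _ _ _ mu Y (measurable_itv _) _ _ (EFin \o g)) => //.
- move=> k; apply/measurable_EFinP/measurable_funM.
    exact: measurable_law_round.
  exact: measurable_gamma_pdf.
- move=> y; rewrite /Y/= in_itv/= andbT => y0; apply: cvg_EFin; first exact: nearW.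
  by apply: cvgM; [exact: law_round_cvg|exact: cvg_cst].
- exact: integrable_gamma_pdf.
- move=> k y; rewrite /Y/= in_itv/= andbT => y0; rewrite lee_fin.
  have ry : 0 <= round_up k y by rewrite ltW// (le_lt_trans y0)// round_up_gt.
  rewrite normrM ger0_norm ?law_ge0// ger0_norm ?gamma_pdf_ge0//.
  by rewrite ler_piMl ?gamma_pdf_ge0// law_le1.
Qed.

End fixed_time.

Lemma fnbp_pmf0 n : fnbp_pmf N G n 0 = phi n 0.
Proof.
case: hG => G0 _ _ _ _; rewrite /fnbp_pmf.
have -> : [set w | fnbp N G 0 w = n] = N 0 @^-1` [set n].
  by apply/seteqP; split => w; rewrite /fnbp/= G0.
by rewrite N_law.
Qed.

End subordination.

(** * The fractional Poisson law near time zero *)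

Section fpp_pmf_bounds.
Context {R : realType}.
Implicit Types (beta lam y : R) (n k : nat).

(* The summand of [fpp_pmf] at [n = 0], a Mittag-Leffler series. *)
Let ml_term beta (x : R) k : R :=
  (0 + k)`!%:R / k`!%:R * ((- x) ^+ k / Gamma (beta * (k + 0)%:R + 1)).

Let fpp_pmf0E beta lam y :
  fpp_pmf beta lam 0 y = limn (series (ml_term beta (lam * y `^ beta))).
Proof. by rewrite /fpp_pmf expr0 divr1 mul1r. Qed.

Let ml_term0 beta (x : R) : ml_term beta x 0 = 1.
Proof. by rewrite /ml_term expr0 mulr0 add0r Gamma1 !divr1 mulr1. Qed.

Lemma fpp_pmf_at0 beta lam n : 0 < beta -> fpp_pmf beta lam n 0 = (n == 0%N)%:R.
Proof.
move=> b0; case: n => [|n]; last first.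
  by rewrite /fpp_pmf powR0 ?(gt_eqF b0)// mulr0 expr0n/= !mul0r.
rewrite fpp_pmf0E powR0 ?(gt_eqF b0)// mulr0 /=; apply/cvg_lim => //.
apply: cvg_near_cst; near=> k.
have k0 : (0 < k)%N by near: k; exact: nbhs_infty_gt.
rewrite /series/= -(prednK k0) big_nat_recl//= ml_term0 big1 ?addr0// => i _.
by rewrite /ml_term oppr0 expr0n/= mul0r mulr0.
Unshelve. all: by end_near. Qed.

Let ml_term_le beta (x : R) k : 0 < beta -> 0 <= x ->
  `|ml_term beta x k| <= expR 2 * x ^+ k.
Proof.
move=> b0 x0; rewrite /ml_term add0n divff ?pnatr_eq0 -?lt0n ?fact_gt0// mul1r.
have G1 : 1 <= beta * (k + 0)%:R + 1 by rewrite lerDr mulr_ge0// ltW.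
have G0 := Gamma_gt0 (lt_le_trans ltr01 G1).
rewrite normrM normrX normrN (ger0_norm x0) gtr0_norm ?invr_gt0// mulrC.
rewrite ler_wpM2r ?exprn_ge0// -[leRHS]invrK -expRN.
by rewrite lef_pV2 ?posrE ?expR_gt0// Gamma_ge.
Qed.

(** The Mittag-Leffler series [E_beta (- x)] is [1 + O(x)], because [Gamma] is
    bounded away from [0] on [[1, +oo[]. *)
Lemma fpp_pmf0_ge beta lam y : 0 < beta -> 0 <= lam -> lam * y `^ beta <= 2^-1 ->
  1 - 2 * expR 2 * (lam * y `^ beta) <= fpp_pmf beta lam 0 y.
Proof.
move=> b0 l0; rewrite fpp_pmf0E; set x := lam * _ => x12.
have x0 : 0 <= x by rewrite mulr_ge0// powR_ge0.
have cvu : cvgn (series (ml_term beta x)).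
  apply: normed_cvg; apply: (@series_le_cvg _ _ (geometric (expR 2) x)).
  - by move=> k /=; exact: normr_ge0.
  - by move=> k; rewrite /geometric/= mulr_ge0 ?expR_ge0// exprn_ge0.
  - by move=> k /=; exact: ml_term_le.
  - apply: is_cvg_geometric_series; rewrite ger0_norm//; lra.
apply: limr_ge => //; near=> k.
have k0 : (0 < k)%N by near: k; exact: nbhs_infty_gt.
rewrite /series/= -(prednK k0) big_nat_recl//= ml_term0 lerD2l.
(* The factor [1 - 2^-1 ^+ m] makes the induction go through. *)
have H m : `|\sum_(0 <= i < m) ml_term beta x i.+1| <=
    2 * expR 2 * x * (1 - 2^-1 ^+ m).
  elim: m => [|m IH]; first by rewrite big_nil normr0 expr0 subrr mulr0.
  rewrite big_nat_recr//=; apply: (le_trans (ler_normD _ _)).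
  have xm : x ^+ m <= 2^-1 ^+ m by rewrite lerXn2r ?nnegrE ?invr_ge0.
  have := ml_term_le m.+1 b0 x0; rewrite exprS => h.
  have := ler_wpM2l (mulr_ge0 (expR_ge0 2) x0) xm; rewrite -mulrA => h'.
  rewrite exprS; move: IH h h'; move: (2^-1 ^+ m) => q.
  by move: (expR 2 * (x * x ^+ m)) => z; lra.
have := H k.-1; set S := \sum_(_ <= _ < _) _ => HS.
have q0 : 0 <= 2^-1 ^+ k.-1 :> R by rewrite exprn_ge0// invr_ge0.
have ex : 0 <= 2 * expR 2 * x by apply: mulr_ge0 => //; rewrite mulr_ge0 ?expR_ge0.
have : - S <= 2 * expR 2 * x.
  apply: (le_trans (ler_norm _)); rewrite normrN (le_trans HS)//.
  by rewrite ler_piMr// lerBlDr lerDl.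
by rewrite lerNl.
Unshelve. all: by end_near. Qed.

(** Near [0] by the series, elsewhere because the left-hand side is at most [1]. *)
Lemma one_sub_fpp_pmf0_le beta lam y : 0 < beta -> 0 < lam -> 0 < y ->
  0 <= fpp_pmf beta lam 0 y ->
  1 - fpp_pmf beta lam 0 y <= 2 * (expR 2 + 1) * lam * y `^ beta.
Proof.
move=> b0 l0 y0 f0; have yb := powR_ge0 y beta; have e0 := expR_ge0 (2 : R).
have [h|h] := leP (lam * y `^ beta) 2^-1.
  have := fpp_pmf0_ge b0 (ltW l0) h.
  have := mulr_ge0 (ltW l0) yb; rewrite -!mulrA; move: (lam * y `^ beta) => x.
  rewrite !mulrDl mul1r; lra.
have := mulr_ge0 e0 (ltW (lt_trans _ h)); rewrite invr_gt0 ltr0n => /(_ isT).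
by rewrite -!mulrA mulrDl mul1r; lra.
Qed.

End fpp_pmf_bounds.

(** * Riemann-Liouville operators through the Abel kernel *)

Section riemann_liouville_abel.
Context {R : realType}.
Notation mu := (@lebesgue_measure R).
Implicit Types (nu e m t u : R) (f g : R -> R) (k : nat).

Lemma abelMl c f m t : mu.-integrable `]0, t[
    (EFin \o (fun s => f s * (t - s) `^ (- m))) ->
  abel m (fun s => c * f s) t = c * abel m f t.
Proof.
move=> fi; rewrite /abel !abel_kernelE -RintegralZl; last 2 first.
- exact: measurable_itv.
- exact: integrable_itv_oo_cc.
by apply: eq_Rintegral => s _; rewrite mulrA.
Qed.

(** The fundamental theorem of calculus: [abel 0] is the primitive from [0]. *)
Lemma abel0_derive1 e f t : 0 < e -> smooth (- e) f -> 0 < t ->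
  abel 0 (derive1 f) t = f t - f 0.
Proof.
move=> e0 sf t0; have sf' := smooth_derive1 sf.
have es s : 0 <= s -> - e < s by move=> s0; rewrite (lt_le_trans _ s0)// oppr_lt0.
have i0 := integrable_abel_smooth e0 sf' (@ltr01 R) t0.
rewrite /abel abel_kernelE (Rintegral_itv_oo_cc i0).
have E : (fun s => derive1 f s * (t - s) `^ (- 0)) = derive1 f.
  by apply/funext => s; rewrite oppr0 powRr0 mulr1.
rewrite E in i0 *.
apply: (@exhaustion_FTC _ _ _ _ _ f _ (exhaust_0t_lt t0) (exhaust_0t_decr t0)
  (exhaust_0t_incr t0) (exhaust_0t t0) _ _ _ i0).
- move=> x; rewrite /= in_itv/= => /andP[x0 _].
  exact: (smooth_continuous sf' (es _ (ltW x0))).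
- move=> x; rewrite /= in_itv/= => /andP[x0 _].
  exact: (smooth_is_derive sf (es _ (ltW x0))).
- apply: cvgB.
    apply: (@cvg_comp _ _ _ _ f _ (nbhs t)); first exact: cvg_exhaust_0t_r.
    exact: (smooth_continuous sf (es _ (ltW t0))).
  apply: (@cvg_comp _ _ _ _ f _ (nbhs (0 : R))); first exact: cvg_exhaust_0t_l.
  exact: (smooth_continuous sf (es _ (lexx 0))).
Qed.

(** Scale invariance: the integral of [s^-1] would be the same over [[0, t]]
    and over [[0, t / 2]]. *)
Lemma inv_not_integrable t : 0 < t ->
  ~ mu.-integrable `[0, t] (EFin \o (fun s : R => s^-1)).
Proof.
move=> t0 ti; have t20 : 0 < t / 2 by rewrite divr_gt0.
have sc u : 0 < u -> mu.-integrable `[0, u] (EFin \o (fun s : R => s^-1)) ->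
    \int[mu]_(x in `[0, u]) x^-1 = \int[mu]_(x in `[0, 1]) x^-1.
  move=> u0 ui; rewrite (Rintegral_scale u0 ui) -RintegralZl; last 2 first.
  - exact: measurable_itv.
  - exact: (integrable_scale u0 ui).
  by apply: eq_Rintegral => x _; rewrite invfM mulrA divff ?gt_eqF// mul1r.
have t2i : mu.-integrable `[0, (t / 2)] (EFin \o (fun s : R => s^-1)).
  apply: integrableS ti => // x /=; rewrite !in_itv/= => /andP[-> xt] /=; lra.
have := @Rintegral_itvB R (fun s => s^-1) (BLeft 0) (BRight t) (t / 2) ti.
rewrite (sc _ t0 ti) (sc _ t20 t2i) subrr !bnd_simp => H.
have {}H : 0 = \int[mu]_(x in `](t / 2), t]) x^-1 by apply: H; lra.
have it : mu.-integrable `](t / 2), t] (EFin \o (fun s : R => s^-1)).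
  apply: integrableS ti => // x /=; rewrite !in_itv/= => /andP[tx ->].
  by rewrite andbT; lra.
have hx x : [set` `](t / 2), t]] x -> t^-1 <= x^-1.
  rewrite /= in_itv/= => /andP[tx xt]; rewrite lef_pV2 ?posrE//; lra.
have ic : mu.-integrable `](t / 2), t] (EFin \o (fun=> t^-1)).
  apply: le_integrable_real it => // x /hx.
  by rewrite ger0_norm// invr_ge0 ltW.
have : \int[mu]_(x in `](t / 2), t]) t^-1 <= \int[mu]_(x in `](t / 2), t]) x^-1.
  exact: le_Rintegral ic it hx.
rewrite -H Rintegral_cst; last exact: measurable_itv.
have -> : fine (mu `](t / 2), t]) = t - t / 2.
  by rewrite lebesgue_measure_itv/= lte_fin ifT//; lra.
have -> : t^-1 * (t - t / 2) = 2^-1 by field; rewrite gt_eqF.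
by rewrite leNgt invr_gt0 ltr0n.
Qed.

(** The operators of order [nu - 1] and [nu] are expressed with the same Abel
    integral: their orders have the same fractional part [m]. *)
Section order.
Variable nu : R.
Hypothesis nu0 : 0 <= nu.
Let K := Num.truncn nu.
Let m := nu - K%:R.

Lemma frac_order : 0 <= m < 1.
Proof.
have /andP[h1 h2] := truncn_itv nu0; rewrite subr_ge0 h1 /m ltrBlDr.
by rewrite addrC natr1.
Qed.

Lemma truncn_lt1 : nu < 1 -> K = 0%N.
Proof. by move=> nu1; apply: truncn_def; rewrite nu0. Qed.

Lemma truncn_pred : 1 <= nu -> (Num.truncn (nu - 1)).+1 = K.
Proof.
move=> nu1; have nu10 : 0 <= nu - 1 by rewrite subr_ge0.
have /andP[h1 h2] := truncn_itv nu10; symmetry; apply: truncn_def.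
by rewrite -!natr1; rewrite -natr1 in h2; lra.
Qed.

Hypothesis nunat : ~ (0 < nu /\ nu \is a Num.nat).

Lemma pred_notin_nat : 1 <= nu -> nu - 1 \isn't a Num.nat.
Proof.
move=> nu1; apply/negP => h; apply: nunat; split; first exact: lt_le_trans nu1.
by rewrite -(subrK 1 nu) rpredD// rpred1.
Qed.

Lemma abel_lt1 f t : nu < 1 ->
  (fun s => (t - s) `^ (- (nu - 1) - 1) * f s) = (fun s => f s / (t - s) `^ m).
Proof.
move=> nu1; apply/funext => s; rewrite /m truncn_lt1// subr0 mulrC -powRN.
by congr (_ * _ `^ _); ring.
Qed.

Lemma abel_ge1 : 1 <= nu -> nu - 1 - (Num.truncn (nu - 1)).+1%:R + 1 = m.
Proof. by move=> nu1; rewrite truncn_pred// /m; ring. Qed.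

Lemma RL_deriv_pred f t :
  RL_deriv (nu - 1) f t = (Gamma (1 - m))^-1 * derive1n K (abel m f) t.
Proof.
rewrite /RL_deriv subr_lt0; have [nu1|nu1] := ltP nu 1.
  have -> : 1 - m = - (nu - 1) by rewrite /m (truncn_lt1 nu1); ring.
  by rewrite (truncn_lt1 nu1) derive1n0 /abel (abel_lt1 f t nu1).
have -> : 1 - m = (Num.truncn (nu - 1)).+1%:R - (nu - 1).
  by rewrite (truncn_pred nu1) /m; ring.
by rewrite (negbTE (pred_notin_nat nu1)) /= (abel_ge1 nu1) -derive1nS
  (truncn_pred nu1).
Qed.

Lemma RL_exists_pred f t :
  (forall u, 0 < u -> mu.-integrable `[0, u] (EFin \o (fun s => f s / (u - s) `^ m))) ->
  smooth 0 (abel m f) -> 0 < t -> RL_exists (nu - 1) f t.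
Proof.
move=> fi sf t0; split; rewrite ?subr_lt0 ?subr_ge0.
- move=> nu1; have := fi t t0; rewrite -(abel_lt1 f t nu1); exact.
- by move=> nu1 nn; have := pred_notin_nat nu1; rewrite nn.
- move=> nu1 _ /=; rewrite (abel_ge1 nu1) (truncn_pred nu1).
  split; last exact: smooth_derivable_n sf t0.
  by near=> u; apply: fi; near: u; exact: lt_nbhsr.
Unshelve. all: by end_near. Qed.

(** A necessary condition for existence, used to refute it. *)
Lemma RL_exists_pred_integrable f t : 0 < t -> RL_exists (nu - 1) f t ->
  mu.-integrable `[0, t] (EFin \o (fun s => f s / (t - s) `^ m)).
Proof.
move=> t0 [H1 _ H3]; have [nu1|nu1] := ltP nu 1.
  have := H1; rewrite subr_lt0 => /(_ nu1) H.
  by rewrite -(abel_lt1 f t nu1); exact: H.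
have := H3; rewrite subr_ge0 /= => /(_ nu1 (pred_notin_nat nu1))[/nbhs_singleton + _].
by rewrite (abel_ge1 nu1).
Qed.

Hypothesis nu_gt0 : 0 < nu.

Let nu_notin : nu \isn't a Num.nat.
Proof. by apply/negP => h; exact: nunat. Qed.

Let exponent : nu - K.+1%:R + 1 = m.
Proof. by rewrite /m -natr1; ring. Qed.

Lemma RL_deriv_abel f t :
  RL_deriv nu f t = (Gamma (1 - m))^-1 * derive1n K.+1 (abel m f) t.
Proof.
have -> : 1 - m = K.+1%:R - nu by rewrite /m -natr1; ring.
by rewrite /RL_deriv ltNge nu0 (negbTE nu_notin) /= exponent.
Qed.

Lemma RL_exists_abel f t :
  (forall u, 0 < u -> mu.-integrable `[0, u] (EFin \o (fun s => f s / (u - s) `^ m))) ->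
  smooth 0 (abel m f) -> 0 < t -> RL_exists nu f t.
Proof.
move=> fi sf t0; split => [nu_lt0|_ nn|_ _ /=].
- by have := lt_le_trans nu_lt0 nu0; rewrite ltxx.
- by have := nu_notin; rewrite nn.
- rewrite exponent; split; last exact: smooth_derivable_n sf t0.
  by near=> u; apply: fi; near: u; exact: lt_nbhsr.
Unshelve. all: by end_near. Qed.

End order.

(** The mass function agrees with its smooth extension at positive times only; the
    remaining point [0] of [[0, t]] is negligible. *)
Section smooth_version.
Variables (e m : R) (f g : R -> R).
Hypotheses (e0 : 0 < e) (m1 : m < 1) (sg : smooth (- e) g).
Hypothesis fg : forall s, 0 < s -> f s = g s.

Lemma integrable_abel_eq u : 0 < u ->
  mu.-integrable `[0, u] (EFin \o (fun s => f s / (u - s) `^ m)).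
Proof.
move=> u0; apply: integrable_itv_oo_cc; rewrite abel_kernelE.
apply: eq_integrable_real (integrable_abel_smooth e0 sg m1 u0) => //.
by move=> s; rewrite /= in_itv/= => /andP[s0 _]; rewrite fg.
Qed.

Lemma abel_eq t : 0 < t -> abel m f t = abel m g t.
Proof.
move=> t0; symmetry; apply: (eq_abel_smooth e0 m1 _ sg t0) => s s0.
by rewrite fg.
Qed.

Lemma smooth_abel_eq : smooth 0 (abel m f).
Proof.
apply: eq_smooth (smooth_abel e0 m1 sg) => t t0; by rewrite abel_eq.
Qed.

Lemma derive1n_abel_eq k t : 0 < t ->
  derive1n k (abel m f) t = derive1n k (abel m g) t.
Proof. by move=> t0; apply: (@eq_derive1n _ _ 0 _ _ _ abel_eq t0). Qed.

End smooth_version.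

End riemann_liouville_abel.

Section RL_nat.
Context {R : realType}.
Implicit Types (f : R -> R) (t : R) (k : nat).

Lemma RL_deriv_nat k f t : RL_deriv k%:R f t = derive1n k f t.
Proof. by rewrite /RL_deriv ltrn0 natr_nat natrK. Qed.

Lemma RL_exists_nat k f t : smooth 0 f -> 0 < t -> RL_exists k%:R f t.
Proof.
move=> sf t0; split; first by rewrite ltrn0.
  by move=> _ _; rewrite natrK; exact: smooth_derivable_n sf t0.
by move=> _; rewrite natr_nat.
Qed.

End RL_nat.

(** * The gamma density as a function of time *)

Section gamma_density_in_time.
Context {R : realType}.
Notation mu := (@lebesgue_measure R).
Variables (alpha p : R).
Hypotheses (alpha0 : 0 < alpha) (p0 : 0 < p).
Implicit Types (s t y : R).

Let q s := p * (expR (p * ln alpha * s) * (Gamma (p * s + 1))^-1).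

(** Writing [1 / Gamma (p * s)] as [p * s / Gamma (p * s + 1)] extends the
    normalising constant of the density smoothly across [s = 0]. *)
Definition gcoef s := s * q s.

Lemma gcoef0 : gcoef 0 = 0. Proof. exact: mul0r. Qed.

Let smooth_q : smooth (- p^-1) q.
Proof.
have ps1 s : - p^-1 < s -> 0 < p * s + 1.
  by move=> ps; rewrite -ltrBlDr sub0r -(mulrV (unitf_gt0 p0)) -mulrN ltr_pM2l.
apply: (@smoothMl _ _ p _); apply: smoothM; first exact: smooth_expRM.
apply: smoothV.
  by move=> s /ps1 h; rewrite gt_eqF// Gamma_gt0.
by apply: smooth_affine (@smooth_Gamma R) => s; exact: ps1.
Qed.

Lemma smooth_gcoef : smooth (- p^-1) gcoef.
Proof. exact: smoothM (@smooth_id _ _) smooth_q. Qed.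

Let opV0 : - p^-1 < 0. Proof. by rewrite oppr_lt0 invr_gt0. Qed.

Lemma gcoefE s : 0 < s -> gcoef s = alpha `^ (p * s) / Gamma (p * s).
Proof.
move=> s0; have ps0 : 0 < p * s by rewrite mulr_gt0.
have G0 := Gamma_gt0 ps0.
rewrite /gcoef /q GammaS// /powR (gt_eqF alpha0).
have -> : p * ln alpha * s = p * s * ln alpha by ring.
by field; rewrite !gt_eqF.
Qed.

(** The logarithmic derivative of the normalising constant. *)
Lemma derive1_gcoef s : 0 < s ->
  derive1 gcoef s = p * (ln alpha - digamma (p * s)) * gcoef s.
Proof.
move=> s0; have ps0 : 0 < p * s by rewrite mulr_gt0.
have G0 := Gamma_gt0 ps0.
pose h := (fun s => expR (p * ln alpha * s)) * (fun s => (Gamma (p * s))^-1).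
have gh x : 0 < x -> gcoef x = h x.
  move=> x0; rewrite gcoefE// /powR (gt_eqF alpha0).
  by have -> : p * x * ln alpha = p * ln alpha * x by ring.
rewrite (eq_derive1 gh s0) (gh _ s0).
have dG := is_derive_scale_arg (smooth_is_derive (@smooth_Gamma R) ps0).
have d1 := is_deriveV (f := fun s => Gamma (p * s)) (lt0r_neq0 G0) dG.
have d2 := is_derive_expRM (p * ln alpha) s.
have /is_derive_derive1[_ ->] := is_deriveM d2 d1.
rewrite /GRing.scale/= /digamma.
change (h s) with (expR (p * ln alpha * s) * (Gamma (p * s))^-1).
by field; rewrite gt_eqF.
Qed.

(** At [s = 0] both sides vanish, by convention for the density and because of
    [gcoef] for the atom. *)
Lemma gamma_pdf_atom s y : 0 <= s -> 0 < y ->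
  gamma_pdf alpha (p * s) y = atom alpha p gcoef 0 y s.
Proof.
move=> s0 y0; rewrite /gamma_pdf y0/= pmulr_rgt0//.
move: s0; rewrite le_eqVlt => /predU1P[<-|s0].
  by rewrite ltxx /atom gcoef0 mul0r.
by rewrite s0 /atom gcoefE// /mterm/= expr0 !mul1r mulrA.
Qed.

(** The derivative of [gcoef] at [0], which is [p], accounts for [- digamma (p * s)] being equivalent
    to [1 / (p * s)]. *)
Lemma cvg_mul_log_sub_digamma :
  s * (ln alpha - digamma (p * s)) @[s --> 0^'+] --> p^-1.
Proof.
have q0 : q 0 = p by rewrite /q !mulr0 expR0 add0r Gamma1 invr1 !mulr1.
have d0 : derive1 gcoef 0 = p.
  have d1 := is_deriveM (is_derive_id (0 : R) (1 : R)) (smooth_is_derive smooth_q opV0).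
  have /is_derive_derive1[_ E] := d1.
  have -> : gcoef = id * q by [].
  by rewrite E q0 /GRing.scale/= mul0r add0r mulr1.
have c1 : derive1 gcoef s @[s --> 0^'+] --> p.
  rewrite -[X in _ --> X]d0; apply: cvg_at_right_filter.
  exact: smooth_continuous (smooth_derive1 smooth_gcoef) opV0.
have c2 : q s @[s --> 0^'+] --> p.
  rewrite -[X in _ --> X]q0; apply: cvg_at_right_filter.
  exact: smooth_continuous smooth_q opV0.
have pn0 : p * p != 0 by rewrite mulf_neq0 ?gt_eqF.
have c3 : (p * q s)^-1 @[s --> 0^'+] --> (p * p)^-1.
  by apply: cvgV => //; apply: cvgM => //; exact: cvg_cst.
have pE : p * (p * p)^-1 = p^-1 by field; rewrite gt_eqF.
have c4 : derive1 gcoef s * (p * q s)^-1 @[s --> 0^'+] --> p^-1.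
  by rewrite -pE; exact: cvgM.
apply: cvg_trans c4; apply: near_eq_cvg; near=> s.
have s0 : 0 < s by near: s; exact: nbhs_right_gt.
have qs0 : 0 < q s.
  rewrite /q mulr_gt0// mulr_gt0 ?expR_gt0// invr_gt0 Gamma_gt0//.
  by rewrite addr_gt0// mulr_gt0.
change (derive1 gcoef s * (p * q s)^-1 = s * (ln alpha - digamma (p * s))).
rewrite derive1_gcoef// /gcoef; field.
by rewrite (gt_eqF qs0) (gt_eqF p0).
Unshelve. all: by end_near. Qed.

End gamma_density_in_time.

(** * The fractional negative binomial process *)

Section fnbp.
Context {R : realType} {d : measure_display} {T : measurableType d}.
Variable P : probability T R.
Notation mu := (@lebesgue_measure R).
Variables (beta alpha p lam : R).
Variables (N : R -> {RV P >-> nat}) (G : R -> {RV P >-> R}).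
Hypotheses (hbeta0 : 0 < beta) (hbeta1 : beta <= 1) (halpha : 0 < alpha)
  (hp : 0 < p) (hlam0 : 0 < lam).
Hypotheses (hN : is_fpp beta lam N) (hG : is_gamma_process alpha p G)
  (hNG : independent_processes N G).
Implicit Types (n k : nat) (t s y nu : R).

Let phi := fpp_pmf beta lam.
Let gc := gcoef alpha p.
Let Y : set R := [set` `]0, +oo[].
Let C := 2 * (expR 2 + 1) * lam.

Let C0 : 0 <= C.
Proof. by rewrite mulr_ge0 ?(ltW hlam0)// mulr_ge0// addr_ge0// expR_ge0. Qed.

Let N_law n t : 0 <= t -> P (N t @^-1` [set n]) = (phi n t)%:E.
Proof. by case: hN => H _ _; exact: H. Qed.

Let N_right w t : 0 <= t -> \forall s \near t^'+, N s w = N t w.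
Proof. by case: hN => _ _; exact. Qed.

Let phi_ge0 n y : 0 < y -> 0 <= phi n y.
Proof. by move=> y0; apply: (law_ge0 N_law); exact: ltW. Qed.

Let measurable_phi n : measurable_fun Y (phi n).
Proof.
apply: measurable_funS (measurable_law N_law N_right n) => //.
by move=> y; rewrite /Y /= !in_itv/= !andbT; exact: ltW.
Qed.

Let phi_le1 n y : 0 < y -> `|phi n y| <= 1 * y `^ 0.
Proof.
move=> y0; rewrite powRr0 mulr1 ger0_norm ?phi_ge0//.
by apply: (law_le1 N_law); exact: ltW.
Qed.

Let one_sub_phi0 y : 0 < y -> `|1 - phi 0 y| <= C * y `^ beta.
Proof.
move=> y0; rewrite ger0_norm.
  by apply: one_sub_fpp_pmf0_le => //; exact: phi_ge0.
by rewrite subr_ge0; apply: (law_le1 N_law); exact: ltW.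
Qed.

Let phi_pos n y : (0 < n)%N -> 0 < y -> `|phi n y| <= C * y `^ beta.
Proof.
move=> n0 y0; rewrite ger0_norm ?phi_ge0//.
apply: (le_trans (law_compl N_law n0 (ltW y0))).
by apply: le_trans (one_sub_phi0 y0); rewrite ler_norm.
Qed.

Let b00 : - 0 <= p * 0. Proof. by rewrite mulr0 oppr0. Qed.

Let smooth_gc0 : smooth 0 gc.
Proof.
apply: smoothW (@smooth_gcoef _ alpha p hp).
by rewrite oppr_le0 invr_ge0 ltW.
Qed.

Let delta n := fnbp_pmf N G n.
(* [delta] and the logarithmic integral, extended to all times by formulas that
   are smooth across [0] when [0 < n]. *)
Let A n := atom_moment alpha p (phi n) gc 0.
Let H n := atom_moment alpha p (phi n) gc 1.

Lemma integral_gamma_weight (w : R -> R) b K t : measurable_fun Y w -> 0 <= K ->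
  (forall y, 0 < y -> `|w y| <= K * y `^ b) -> - b < p * t -> 0 < t ->
  mu.-integrable Y (EFin \o (fun y => w y * gamma_pdf alpha (p * t) y)) /\
  \int[mu]_(y in Y) (w y * gamma_pdf alpha (p * t) y) =
  atom_moment alpha p w gc 0 t.
Proof.
move=> mw K0 wK bt t0.
have E y : Y y -> gc t * mterm w alpha 0 (p * t) y =
    w y * gamma_pdf alpha (p * t) y.
  rewrite /Y/= in_itv/= andbT => y0; rewrite (gamma_pdf_atom halpha hp (ltW t0) y0).
  by rewrite /atom /mterm /= /gc; ring.
have i1 := integrable_mterm halpha mw K0 wK 0 bt.
split.
  by apply: eq_integrable_real (integrable_realZ _ (gc t) i1) => //; exact: E.
rewrite /atom_moment /moment -RintegralZl; [|exact: measurable_itv|exact: i1].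
by apply: eq_Rintegral => y /set_mem Yy; rewrite E.
Qed.

Lemma fnbp_pmfE n t : 0 < t -> delta n t = A n t.
Proof.
move=> t0; have pt0 : 0 < p * t by rewrite mulr_gt0.
have bt : - 0 < p * t by rewrite oppr0.
have [i1 e1] := integral_gamma_weight (measurable_phi n) ler01 (@phi_le1 n) bt t0.
have [_] := fnbp_probability N_law N_right hG hNG n t0 pt0.
rewrite /delta /fnbp_pmf => ->; rewrite /A -e1.
rewrite /Y Rintegral_itv_obnd_cbnd; first by [].
exact: i1.
Qed.

Let derive1_A n s : 0 < s ->
  derive1 (A n) s = p * (ln alpha - digamma (p * s)) * A n s + p * H n s.
Proof.
move=> s0.
rewrite /A (derive1_atom_moment hp halpha (measurable_phi n) ler01 (@phi_le1 n)
  0 b00 smooth_gc0 s0).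
by rewrite /H /atom_moment (derive1_gcoef halpha hp s0) /gc; ring.
Qed.

(** The equation of order one. *)
Lemma fnbp_driftE n s : 0 < s ->
  drift alpha p (delta n) s = p^-1 * derive1 (A n) s - H n s.
Proof.
move=> s0; rewrite /drift fnbp_pmfE// derive1_A//; field.
by rewrite gt_eqF.
Qed.

Let smooth_A0 n : smooth 0 (A n).
Proof.
exact: (smooth_atom_moment hp halpha (measurable_phi n) ler01 (@phi_le1 n) b00 smooth_gc0).
Qed.

Let smooth_H0 n : smooth 0 (H n).
Proof.
exact: (smooth_atom_moment hp halpha (measurable_phi n) ler01 (@phi_le1 n) b00 smooth_gc0).
Qed.

Let equation nu n t :=
  [/\ rhs_exists nu beta alpha p lam n (delta n) t,
      RL_exists nu (delta n) t &
      p^-1 * RL_deriv nu (delta n) t =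
        RL_deriv (nu - 1) (drift alpha p (delta n)) t +
        \int[mu]_(y in `]0, +oo[) log_integrand nu beta alpha p lam n t y].

(** For a positive integer order everything is local in time, and the equation
    is the derivative of order [k] of the first-order one. *)
Lemma fnbp_equation_nat k n t : 0 < t -> equation k.+1%:R n t.
Proof.
move=> t0; have kE : k.+1%:R - 1 = k%:R :> R by rewrite -natr1 addrK.
have AE : forall s, 0 < s -> A n s = delta n s by move=> s s0; rewrite fnbp_pmfE.
have dE : forall s, 0 < s -> p^-1 * derive1 (A n) s - H n s =
    drift alpha p (delta n) s by move=> s s0; rewrite fnbp_driftE.
have sA' := smooth_derive1 (@smooth_A0 n).
have sd : smooth 0 (drift alpha p (delta n)).
  apply: eq_smooth dE _; apply: smoothB (@smooth_H0 n).
  exact: (@smoothMl _ _ p^-1 _ sA').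
have gE y : 0 < y -> forall s, 0 < s -> atom alpha p gc 0 y s =
    gamma_pdf alpha (p * s) y.
  by move=> y0 s s0; rewrite (gamma_pdf_atom halpha hp (ltW s0) y0).
have [i1 e1] := derive1n_integral_atom hp halpha (measurable_phi n) ler01
  (@phi_le1 n) k 0 (lexx 0) smooth_gc0 t0.
have lE y : Y y -> phi n y * ln y * derive1n k (atom alpha p gc 0 y) t =
    log_integrand k.+1%:R beta alpha p lam n t y.
  rewrite /Y/= in_itv/= andbT => y0; rewrite /log_integrand kE RL_deriv_nat.
  by rewrite (eq_derive1n k (gE y y0) t0).
split.
- split.
  + by rewrite kE; exact: RL_exists_nat.
  + move=> y y0; rewrite kE; apply: RL_exists_nat t0.
    exact: (@eq_smooth _ _ _ _ (gE y y0) (@smooth_atom _ _ _ hp _ _ _ _ smooth_gc0 y0)).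
  + by apply: (@eq_integrable_real _ _ _ mu _ _ _ _ lE i1); exact: measurable_itv.
- by apply: RL_exists_nat t0; exact: eq_smooth AE (@smooth_A0 n).
- have -> : \int[mu]_(y in `]0, +oo[) log_integrand k.+1%:R beta alpha p lam n t y =
      derive1n k (H n) t.
    by rewrite -e1; apply: eq_Rintegral => y /set_mem Yy; rewrite -lE.
  rewrite kE !RL_deriv_nat.
  rewrite -(eq_derive1n _ AE t0) -(eq_derive1n _ dE t0) derive1Sn.
  rewrite (derive1nB k (@smoothMl _ _ p^-1 _ sA') (@smooth_H0 n) t0).
  by rewrite (derive1nMl k p^-1 sA' t0) subrK.
Qed.

(* The weight [phi n] being [O(y^beta)], the moments at [p * s] exist as soon as
   [- beta < p * s]. *)
Let e := beta / p.
Let e0 : 0 < e. Proof. exact: divr_gt0. Qed.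

Let bpe : - beta <= p * - e.
Proof. by rewrite /e mulrN mulrCA divff ?mulr1// gt_eqF. Qed.

Let smooth_gc : smooth (- e) gc.
Proof.
apply: smoothW (@smooth_gcoef _ alpha p hp).
by rewrite lerN2 /e ler_piMl// invr_ge0 ltW.
Qed.

Section positive_count.
Variable n : nat.
Hypothesis n0 : (0 < n)%N.

Let smooth_A : smooth (- e) (A n).
Proof.
exact: (smooth_atom_moment hp halpha (measurable_phi n) C0
  (fun y => @phi_pos n y n0) bpe smooth_gc).
Qed.

Let smooth_H : smooth (- e) (H n).
Proof.
exact: (smooth_atom_moment hp halpha (measurable_phi n) C0
  (fun y => @phi_pos n y n0) bpe smooth_gc).
Qed.

Let A0 : A n 0 = 0. Proof. by rewrite /A /atom_moment /gc gcoef0 mul0r. Qed.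

(** The Riemann-Liouville operator of order [nu - 1] is applied to the equation of
    order one; as [A n] vanishes at [0], the additional derivative in the operator
    of order [nu] falls on [A n] under the Abel kernel. *)
Lemma fnbp_equation_frac nu t : 0 <= nu -> ~ (0 < nu /\ nu \is a Num.nat) ->
  0 < t -> equation nu n t.
Proof.
move=> nu0 nunat t0; pose K := Num.truncn nu; pose m := nu - K%:R.
have /andP[m0 m1] := frac_order nu0; rewrite -/K -/m in m0 m1.
have AE : forall s, 0 < s -> delta n s = A n s by move=> s s0; rewrite fnbp_pmfE.
have dE : forall s, 0 < s -> drift alpha p (delta n) s =
    p^-1 * derive1 (A n) s - H n s by move=> s s0; rewrite fnbp_driftE.
have sA' := smooth_derive1 smooth_A.
have spA' : smooth (- e) (fun s => p^-1 * derive1 (A n) s).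
  exact: (@smoothMl _ _ p^-1 _ sA').
have sd : smooth (- e) (fun s => p^-1 * derive1 (A n) s - H n s).
  exact: smoothB spA' smooth_H.
have gE y : 0 < y -> forall s, 0 < s -> gamma_pdf alpha (p * s) y =
    atom alpha p gc 0 y s.
  by move=> y0 s s0; rewrite (gamma_pdf_atom halpha hp (ltW s0) y0).
have sg y : 0 < y -> smooth (- e) (atom alpha p gc 0 y).
  by move=> y0; exact: (@smooth_atom _ _ _ hp _ _ _ _ smooth_gc y0).
have [i1 e1] := derive1n_integral_abel_atom hp halpha (measurable_phi n) C0
  (fun y => @phi_pos n y n0) hbeta0 m1 K 0 smooth_gc t0.
pose c := (Gamma (1 - m))^-1.
have lE y : Y y -> c * (phi n y * ln y * derive1n K (abel m (atom alpha p gc 0 y)) t)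
    = log_integrand nu beta alpha p lam n t y.
  rewrite /Y/= in_itv/= andbT => y0; rewrite /log_integrand.
  rewrite (RL_deriv_pred nu0 nunat) -/K -/m -/c.
  by rewrite (derive1n_abel_eq e0 m1 (sg y y0) (gE y y0) K t0) mulrCA.
have abel_drift : RL_deriv (nu - 1) (drift alpha p (delta n)) t =
    c * (p^-1 * derive1n K (abel m (derive1 (A n))) t - derive1n K (abel m (H n)) t).
  rewrite (RL_deriv_pred nu0 nunat) -/K -/m -/c.
  rewrite (derive1n_abel_eq e0 m1 sd dE K t0); congr (_ * _).
  have s1 := smooth_abel e0 m1 sA'; have s2 := smooth_abel e0 m1 smooth_H.
  rewrite -(derive1nMl K p^-1 s1 t0).
  rewrite -(derive1nB K (@smoothMl _ _ p^-1 _ s1) s2 t0).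
  apply: (@eq_derive1n _ _ 0 _ _ _ _ t0) => s s0.
  have sN : smooth (- e) (fun s => -1 * H n s) by exact: (@smoothMl _ _ (-1) _ smooth_H).
  have -> : (fun s => p^-1 * derive1 (A n) s - H n s) =
      (fun s => p^-1 * derive1 (A n) s + -1 * H n s).
    by apply/funext => r; rewrite mulN1r.
  rewrite (abelD e0 m1 spA' sN s0).
  rewrite (abelMl _ (integrable_abel_smooth e0 sA' m1 s0)).
  by rewrite (abelMl _ (integrable_abel_smooth e0 smooth_H m1 s0)) mulN1r.
have integral_log : \int[mu]_(y in `]0, +oo[) log_integrand nu beta alpha p lam n t y =
    c * derive1n K (abel m (H n)) t.
  rewrite -e1 -RintegralZl; [|exact: measurable_itv|exact: i1].
  by apply: eq_Rintegral => y /set_mem Yy; rewrite lE.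
split.
- split.
  + apply: (RL_exists_pred nu0 nunat) t0.
      by move=> u u0; exact: (integrable_abel_eq e0 m1 sd dE u0).
    exact: (smooth_abel_eq e0 m1 sd dE).
  + move=> y y0; apply: (RL_exists_pred nu0 nunat) t0.
      by move=> u u0; exact: (integrable_abel_eq e0 m1 (sg y y0) (gE y y0) u0).
    exact: (smooth_abel_eq e0 m1 (sg y y0) (gE y y0)).
  + apply: (@eq_integrable_real _ _ _ mu _ _ _ _ lE).
      exact: measurable_itv.
    by apply: integrable_realZ; [exact: measurable_itv|exact: i1].
- move: (nu0); rewrite le_eqVlt => /predU1P[<-|nu_gt0].
    apply: (@RL_exists_nat _ 0 (delta n) t _ t0).
    by apply: (@eq_smooth _ 0 (A n)); [move=> s s0; rewrite AE|exact: (@smooth_A0 n)].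
  apply: (RL_exists_abel nu0 nunat nu_gt0) t0.
    by move=> u u0; exact: (integrable_abel_eq e0 m1 smooth_A AE u0).
  exact: (smooth_abel_eq e0 m1 smooth_A AE).
- rewrite abel_drift integral_log -mulrDr subrK.
  have [nu_gt0|nu_le0] := ltP 0 nu.
    rewrite (RL_deriv_abel nu0 nunat nu_gt0) -/K -/m -/c.
    rewrite (derive1n_abel_eq e0 m1 smooth_A AE K.+1 t0).
    by rewrite (derive1nS_abel e0 m1 K smooth_A t0) A0 mul0r add0r mulrCA.
  (* For [nu = 0] the equation is the integral form of the one of order one. *)
  have nuE : nu = 0 by apply/eqP; rewrite eq_le nu_le0.
  have KE : K = 0%N by rewrite /K nuE truncn0.
  have mE : m = 0 by rewrite /m nuE KE subrr.
  rewrite /c mE KE subr0 Gamma1 invr1 mul1r derive1n0.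
  rewrite (abel0_derive1 e0 smooth_A t0) A0 subr0 nuE.
  by rewrite (RL_deriv_nat 0) derive1n0 AE.
Qed.

End positive_count.

Let W := atom_moment alpha p (fun y => 1 - phi 0 y) gc 0.

Let measurable_one_sub : measurable_fun Y (fun y => 1 - phi 0 y).
Proof. by apply: measurable_funB; [exact: measurable_cst|exact: measurable_phi]. Qed.

Let fnbp_pmf0E s : 0 < s -> delta 0 s = 1 - W s.
Proof.
move=> s0; have b0 : - 0 < p * s by rewrite oppr0 mulr_gt0.
have bb : - beta < p * s by rewrite (lt_trans _ (mulr_gt0 hp s0))// oppr_lt0.
have c1 y : 0 < y -> `|cst 1 y : R| <= 1 * y `^ 0 by rewrite powRr0 normr1 mulr1.
have mc : measurable_fun Y (cst 1 : R -> R) by exact: measurable_cst.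
have [i1 e1] := integral_gamma_weight mc ler01 c1 b0 s0.
have [i2 e2] := integral_gamma_weight (measurable_phi 0) ler01 (@phi_le1 0) b0 s0.
have [i3 e3] := integral_gamma_weight measurable_one_sub C0 one_sub_phi0 bb s0.
have E1 : \int[mu]_(y in Y) (cst 1 y * gamma_pdf alpha (p * s) y) = 1.
  rewrite /Y Rintegral_itv_obnd_cbnd; last exact: i1.
  rewrite /Rintegral -[RHS]/(fine 1%E) -(integral_gamma_pdf hG s0).
  by congr fine; apply: eq_integral => y _; rewrite mul1r.
rewrite fnbp_pmfE// /A /W -e2 -e3; apply/esym/eqP; rewrite subr_eq -RintegralD.
- rewrite -[X in X == _]E1; apply/eqP/eq_Rintegral => y _ /=; ring.
- exact: measurable_itv.
- exact: i2.
- exact: i3.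
Qed.

(* By smoothness of [W] across [0], where [gcoef] vanishes. *)
Let cvg_fnbp_pmf0 : delta 0 s @[s --> 0^'+] --> (1 : R).
Proof.
have W0 : W 0 = 0 by rewrite /W /atom_moment /gc gcoef0 mul0r.
have sW : smooth (- e) W.
  exact: (smooth_atom_moment hp halpha measurable_one_sub C0 one_sub_phi0 bpe smooth_gc).
have cW : 1 - W s @[s --> 0^'+] --> 1 - W 0.
  apply: cvgB; first exact: cvg_cst.
  apply: cvg_at_right_filter; apply: (@smooth_continuous _ _ _ _ sW).
  by rewrite oppr_lt0.
rewrite W0 subr0 in cW; apply: cvg_trans cW; apply: near_eq_cvg; near=> s.
by rewrite fnbp_pmf0E.
Unshelve. all: by end_near. Qed.

(** The drift is equivalent to [(p * s)^-1] at [0], as [delta 0] tends to [1],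
    and the Abel kernel is bounded below there. *)
Lemma fnbp_rhs_zero_undefined nu t : 0 <= nu -> ~ (0 < nu /\ nu \is a Num.nat) ->
  0 < t -> ~ rhs_exists nu beta alpha p lam 0 (delta 0) t.
Proof.
move=> nu0 nunat t0 [ex _ _].
have int := RL_exists_pred_integrable nu0 nunat t0 ex.
have /andP[m0 m1] := frac_order nu0.
set m := nu - _ in int m0 m1.
have : s * (ln alpha - digamma (p * s)) * delta 0 s @[s --> 0^'+] --> p^-1 * 1.
  by apply: cvgM; [exact: cvg_mul_log_sub_digamma|exact: cvg_fnbp_pmf0].
rewrite mulr1 => /cvgr_gt/(_ (p^-1 / 2)) [].
  by rewrite gtr_pMr ?invr_gt0// invf_lt1// ltr1n.
move=> r /= r0 Hr; pose h := Num.min r t / 2.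
have h0 : 0 < h by rewrite divr_gt0// lt_min r0.
have hr : h < r by rewrite /h ltr_pdivrMr// gt_min; apply/orP; left; lra.
have ht : h < t by rewrite /h ltr_pdivrMr// gt_min; apply/orP; right; lra.
apply: (inv_not_integrable h0); apply: integrable_itv_oo_cc.
pose c := 2 * p * t `^ m.
have ci : mu.-integrable `]0, h[
    (EFin \o (fun s => c * (drift alpha p (delta 0) s / (t - s) `^ m))).
  apply: integrable_realZ; first exact: measurable_itv.
  apply: integrableS int; [exact: measurable_itv|exact: measurable_itv|].
  by move=> s /=; rewrite !in_itv/= => /andP[s0 sh]; rewrite !ltW// (lt_trans sh).
apply: le_integrable_real ci; [exact: measurable_itv| |].
  apply: (@eq_measurable_fun _ _ _ _ _ (fun s : R => s `^ (-1))).
    by move=> s /set_mem/=; rewrite in_itv/= => /andP[s0 _]; rewrite powR_inv1// ltW.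
  exact: measurable_funS (measurable_powR _).
move=> s /=; rewrite in_itv/= => /andP[s0 sh].
rewrite gtr0_norm ?invr_gt0//.
have : p^-1 / 2 < s * (ln alpha - digamma (p * s)) * delta 0 s.
  apply: Hr => //; rewrite /ball_ /= sub0r normrN gtr0_norm//; exact: lt_trans hr.
rewrite -mulrA -/(drift alpha p (delta 0) s); set D := drift _ _ _ _ => HD.
have st : 0 < t - s by rewrite subr_gt0 (lt_trans sh).
have k1 : 1 <= t `^ m / (t - s) `^ m.
  rewrite ler_pdivlMr ?powR_gt0// mul1r ge0_ler_powR// ?nnegrE; lra.
have D1 : s^-1 <= 2 * p * D.
  have sn : s != 0 by rewrite gt_eqF.
  have pn : p != 0 by rewrite gt_eqF.
  have E1 : s^-1 = 2 * p * s^-1 * (p^-1 / 2) by field; rewrite sn pn.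
  have E2 : 2 * p * D = 2 * p * s^-1 * (s * D) by field.
  rewrite [leLHS]E1 E2 ler_wpM2l// ?ltW// !mulr_gt0// invr_gt0//.
apply: (le_trans D1).
have -> : c * (D / (t - s) `^ m) = 2 * p * D * (t `^ m / (t - s) `^ m).
  by rewrite /c; ring.
by rewrite ler_peMr// (le_trans _ D1)// invr_ge0 ltW.
Qed.

End fnbp.

Theorem theorem4p7 (R : realType) (d : measure_display) (T : measurableType d)
    (P : probability T R) (nu beta alpha p lam : R) (n : nat)
    (N : R -> {RV P >-> nat}) (G : R -> {RV P >-> R})
    (hnu : 0 <= nu) (hbeta0 : 0 < beta) (hbeta1 : beta <= 1)
    (halpha : 0 < alpha) (hp : 0 < p)
    (hlam0 : 0 < lam) (hlam1 : lam < alpha `^ beta)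
    (hN : is_fpp beta lam N) (hG : is_gamma_process alpha p G)
    (hNG : independent_processes N G) :
  let delta := fnbp_pmf N G n in
  delta 0 = (n == 0%N)%:R /\
  forall t, 0 < t ->
    ((0 < n)%N \/ (0 < nu /\ nu \is a Num.nat) ->
       rhs_exists nu beta alpha p lam n delta t) /\
    (rhs_exists nu beta alpha p lam n delta t ->
       RL_exists nu delta t /\
       p^-1 * RL_deriv nu delta t =
         RL_deriv (nu - 1)
           (fun s => (ln alpha - digamma (p * s)) * delta s) t +
         \int[lebesgue_measure]_(y in `]0, +oo[)
           (fpp_pmf beta lam n y * ln y *
            RL_deriv (nu - 1) (fun s => gamma_pdf alpha (p * s) y) t)).
Proof.
move=> delta; split.
  have N_law k u : 0 <= u -> P (N u @^-1` [set k]) = (fpp_pmf beta lam k u)%:E.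
    by case: hN => H _ _; exact: H.
  by rewrite /delta (fnbp_pmf0 N_law hG) fpp_pmf_at0.
move=> t t0.
have [[nu_gt0 /natrP[[|k] nuE]]|nunat] := pselect (0 < nu /\ nu \is a Num.nat).
- by move: nu_gt0; rewrite nuE ltxx.
- rewrite nuE; have [ex ex_delta eqn] := fnbp_equation_nat halpha hp hN hG hNG k n t0.
  by split=> [_|_]; [exact: ex|split; [exact: ex_delta|exact: eqn]].
have [n0|n0] := posnP n.
  rewrite /delta n0; split=> [[//|/nunat//]|ex].
  by case: (fnbp_rhs_zero_undefined hbeta0 hbeta1 halpha hp hlam0 hN hG hNG hnu nunat
    t0 ex).
have [ex ex_delta eqn] :=
  fnbp_equation_frac hbeta0 hbeta1 halpha hp hlam0 hN hG hNG n0 hnu nunat t0.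
by split=> [_|_]; [exact: ex|split; [exact: ex_delta|exact: eqn]].
Qed.
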